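(* Let $\Omega$ be an open, strictly convex subset of $\mathbb{R}^2$ with smooth boundary, axially symmetric (i.e. $(x,y)\in\Omega$ implies $(-x,y),(x,-y)\in\Omega$), and satisfying $[-1,1]\times[-1,1]\subset\Omega\subset[-\tfrac43,\tfrac43]\times[-\tfrac43,\tfrac43]$. Let $u:\Omega\to\mathbb{R}$ be a convex solution of \[ \frac{\det D^2u}{(1+|Du|^2)^{3/2}}=\frac{2\pi}{\mathcal{A}(\Omega)}\ \text{in }\Omega,\qquad \lim_{x\to\partial\Omega}|Du|(x)=+\infty, \] where $\mathcal{A}(\Omega)$ is the area of $\Omega$. Then for every $\alpha\in(0,1/6)$, \[ u(1-6\alpha,-1)-u(0,0)\le 6\Big(1+\frac{1}{\alpha^2}\Big). \] *)

(* Defs.v *)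
From HB Require Import structures.
From mathcomp Require Import all_boot all_order all_algebra.
From mathcomp Require Import all_classical all_reals all_analysis.
Set Implicit Arguments. Unset Strict Implicit. Unset Printing Implicit Defensive.
Import Order.TTheory GRing.Theory Num.Theory.
Import numFieldNormedType.Exports.
Local Open Scope classical_set_scope.
Local Open Scope ring_scope.

Section Defs.
Variable R : realType.
Notation P := (R * R)%type.

Definition e1 : P := (1, 0).
Definition e2 : P := (0, 1).

Definition iterD (vs : seq P) (f : P -> R) : P -> R :=
  foldr (fun v g => 'D_v g) f vs.

Definition smooth_on (U : set P) (f : P -> R) : Prop :=
  forall (vs : seq P) (p : P), U p -> differentiable (iterD vs f) p.

Definition smooth_boundary (O : set P) : Prop :=
  forall q : P, closure O q -> ~ O q ->
    exists (r : R) (F : P -> R), 0 < r /\ smooth_on (ball q r) F /\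
      ('D_e1 F q, 'D_e2 F q) != 0 /\
      forall p, ball q r p -> (O p <-> F p < 0).

Definition strictly_convex_set (O : set P) : Prop :=
  forall p q : P, closure O p -> closure O q -> p != q ->
    forall t : R, 0 < t < 1 -> O (t *: p + (1 - t) *: q).

Definition axially_symmetric (O : set P) : Prop :=
  forall x y : R, O (x, y) -> O (- x, y) /\ O (x, - y).

Definition convex_fun_on (O : set P) (u : P -> R) : Prop :=
  forall p q : P, O p -> O q -> forall t : R, 0 <= t <= 1 ->
    u (t *: p + (1 - t) *: q) <= t * u p + (1 - t) * u q.

Definition C2_on (O : set P) (u : P -> R) : Prop :=
  forall p, O p ->
    differentiable u p /\
    (forall v, v \in [:: e1; e2] -> differentiable ('D_v u) p) /\
    (forall v w, v \in [:: e1; e2] -> w \in [:: e1; e2] ->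
       {for p, continuous ('D_w ('D_v u))}).

Definition area (O : set P) : R :=
  fine ((@lebesgue_measure R \x @lebesgue_measure R)%E O).

Definition gradnorm (u : P -> R) (p : P) : R :=
  Num.sqrt (('D_e1 u p) ^+ 2 + ('D_e2 u p) ^+ 2).

Definition gauss_curv (u : P -> R) (p : P) : R :=
  ('D_e1 ('D_e1 u) p * 'D_e2 ('D_e2 u) p - ('D_e2 ('D_e1 u) p) ^+ 2)
  / (1 + ('D_e1 u p) ^+ 2 + ('D_e2 u p) ^+ 2) `^ (3 / 2).

End Defs.

(* Main.v *)
Require Import Defs.
From HB Require Import structures.
From mathcomp Require Import all_boot all_order all_algebra.
From mathcomp Require Import all_classical all_reals all_analysis.
From mathcomp Require Import measurable_realfun ring lra.
Import Order.TTheory GRing.Theory Num.Theory.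
Import numFieldNormedType.Exports.
Local Open Scope classical_set_scope.
Local Open Scope ring_scope.

(** Write $P = (u_x, u_y)$ and $K = 2\pi / \mathcal{A}(\Omega)$.

    The map $P$ pushes $K$ times the area of $\Omega$ to the measure with density
    $(1 + p^2 + q^2)^{-3/2}$, which gives a rectangle the mass obtained from the
    primitive $\arctan (pq / \sqrt{1 + p^2 + q^2})$.  Differentiating $P$ at one point
    bounds the area of preimages of small rectangles, bisection extends the inequality
    to all rectangles, and it is an equality because the total masses are both $2\pi$.

    Aleksandrov's argument then shows that two convex solutions have the same gradient,
    so $P$ inherits the symmetries of $\Omega$; hence $u$ increases in $x, y > 0$.

    Put $a = 6\alpha$.  A set of area $A$ on which one slope is at least $t$ satisfies
    $K A t \le 1$ in the first quadrant.  Near the corner $(1,1)$ this bounds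
    $u(1 - a/2, 1 - a/2) - u(0,0)$ by $16/(K a^2)$.  Below a point with gradient $(p,q)$,
    monotonicity of $P$ gives a rectangle of height about $pa/q$ where $u_x \ge p/2$, so
    $p^2$ is at most linear in $q$ once $q$ is large.  Consequently the level sets
    $T < u_y \le 4T$ over $[1-a, 1-a/2]$ have area of order $T^{-3/2}$, and integrating
    $u_y$ over dyadic levels bounds the increase of $u$ up to the edge $y = 1$. *)

(** The argument runs on pairs $(p,q)$ with three properties, [curvature_map]: a first order
    expansion of prescribed determinant, monotonicity, closed range. The blow-up of $|Du|$ at the
    boundary serves the third: a value is attained or at positive distance from the range, so a
    small rectangle around it has a preimage that is empty or concentrated near one point. All three
    properties survive reflections, hence a class not tied to the derivatives of one function.

    The dyadic sum is the delicate point. The strip bound alone gives area of order $1/T$ for $u_y >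
    T$, and summing $T \cdot T^{-1}$ over dyadic levels gives no bound independent of their number.
    The estimate of $u_x$ by $\sqrt{u_y}$ gains the factor $T^{-1/2}$ that makes the sum geometric.

    Constants: the edge costs $128/(Ka)$ and the corner $16/(Ka^2)$, in all at most $144/(Ka^2) =
    (4/K)\alpha^{-2}$. From $\mathcal{A}(\Omega) \le (8/3)^2$ and $\pi \ge 13/5$ follows $K \ge
    2/3$, that is $4/K \le 6$. The edge $y = -1$ is reached by reflecting $u$. *)

Local Notation lam2 := (@lebesgue_measure _ \x @lebesgue_measure _)%E.

(** * Lebesgue measure of the plane *)

Section PlaneMeasure.
Variable R : realType.
Local Notation lam := (@lebesgue_measure R).

Lemma open_measurable_plane (U : set (R * R)) :
  open U -> measurable (U : set (measurableTypeR R * measurableTypeR R)).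
Proof.
move=> oU.
pose box (q : (rat * rat) * (rat * rat)) : set (R * R) :=
  `]ratr q.1.1, ratr q.1.2[%classic `*` `]ratr q.2.1, ratr q.2.2[%classic.
have -> : U = \bigcup_(q in [set q | box q `<=` U]) box q.
  apply/seteqP; split => [[x y] Uxy|z [q /= qU qz]]; last exact: qU.
  have [e /= e0 eU] : nbhs_ball (x, y) U by apply/nbhs_ballP; exact: open_nbhs_nbhs.
  have rI (z : R) : exists q : rat * rat,
      (z \in `]ratr q.1, ratr q.2[) /\ (`]ratr q.1, ratr q.2[%classic `<=` ball z e).
    have [a] := @rat_in_itvoo R (z - e) z ltac:(by rewrite ltrBlDr ltrDl).
    have [b] := @rat_in_itvoo R z (z + e) ltac:(by rewrite ltrDl).
    rewrite !in_itv /= => /andP[h1 h2] /andP[h3 h4].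
    exists (a, b); split; rewrite ?in_itv /= ?h1 ?h2 ?h3 ?h4 //.
    move=> t /=; rewrite in_itv /= => /andP[h5 h6].
    by rewrite /ball /= ltr_distl; apply/andP; split; lra.
  have [q1 [xq1 bq1]] := rI x; have [q2 [yq2 bq2]] := rI y.
  exists (q1, q2) => //= -[s t] [/= hs ht]; apply: eU; split; [exact: bq1|exact: bq2].
rewrite bigcup_mkcond; apply: countable_bigcupT_measurable => // q.
case: ifPn => // _; apply: measurableX; exact: measurable_itv.
Qed.

Lemma lebesgue_measure_translate (c : R) (S : set R) : measurable S ->
  lam [set y | S (y + c)] = lam S.
Proof.
move=> mS.
have mf : measurable_fun [set: measurableTypeR R] (fun y : R => y + c : measurableTypeR R).
  exact: measurable_funD.
suff : pushforward lam (fun y : R => y + c : measurableTypeR R) S = lam S by [].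
apply/esym/lebesgue_measure_unique => //= _ [[a b]] _ <-.
rewrite /pushforward (_ : _ @^-1` _ = `]a - c, b - c]%classic); last first.
  by apply/seteqP; split => y /=; rewrite !in_itv /= ltrBlDr lerBrDr.
rewrite !lebesgue_measure_itv/=.
by rewrite !lte_fin ltrD2r; case: ifP => // _; congr (_%:E); ring.
Qed.

(** The product measure integrates the sections at fixed $x$; its uniqueness exchanges the order of
    integration, as the shear in $x$ requires. *)
Lemma lam2_ysectionE (S : set (measurableTypeR R * measurableTypeR R)) :
  measurable S -> lam2 S = (\int[lam]_y lam (ysection S y))%E.
Proof.
move=> mS.
rewrite (@product_measure_unique _ _ _ _ R lam lam (lam \x^ lam)%E) //.
by move=> A B mA mB; rewrite -product_measure2E.
Qed.

Lemma lam2_shear_y (c : R) (S : set (measurableTypeR R * measurableTypeR R)) :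
  measurable S -> lam2 [set z | S (z.1, z.2 + c * z.1)] = lam2 S.
Proof.
move=> mS; apply: eq_integral => x _ /=.
rewrite -[RHS](@lebesgue_measure_translate (c * x)); last exact: measurable_xsection.
by congr (lam _); apply/seteqP; split => y /=; rewrite !xsectionE.
Qed.

Lemma lam2_shear_x (c : R) (S : set (measurableTypeR R * measurableTypeR R)) :
  measurable S -> lam2 [set z | S (z.1 + c * z.2, z.2)] = lam2 S.
Proof.
move=> mS.
rewrite lam2_ysectionE; last first.
  have mf : measurable_fun setT (fun z : measurableTypeR R * measurableTypeR R =>
      ((z.1 + c * z.2, z.2) : measurableTypeR R * measurableTypeR R)).
    apply/measurable_fun_pair => //=.
    by apply: measurable_funD => //; apply: measurable_funM.
  by rewrite -[X in measurable X]setTI; exact: mf.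
rewrite lam2_ysectionE //; apply: eq_integral => y _ /=.
rewrite -[RHS](@lebesgue_measure_translate (c * y)); last exact: measurable_ysection.
by congr (lam _); apply/seteqP; split => x /=; rewrite !ysectionE.
Qed.

Lemma lam2_rectangle (a b c d : R) : a <= b -> c <= d ->
  lam2 (`[a, b]%classic `*` `[c, d]%classic) = ((b - a) * (d - c))%:E.
Proof.
move=> ab cd.
transitivity (lam `[a, b]%classic * lam `[c, d]%classic)%E.
  by apply: product_measure1E; exact: measurable_itv.
rewrite !lebesgue_measure_itv /= !lte_fin.
move: ab cd; rewrite !le_eqVlt => /orP[/eqP ->|->] /orP[/eqP ->|->];
  by rewrite ?ltxx ?subrr ?mul0r ?mulr0 ?mule0 ?mul0e.
Qed.

Lemma measurable_parallelogram (a b c d l1 l2 m1 m2 : R) :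
  measurable ([set z | l1 <= a * z.1 + b * z.2 <= l2 /\
                       m1 <= c * z.1 + d * z.2 <= m2] :
    set (measurableTypeR R * measurableTypeR R)).
Proof.
have mf : measurable_fun setT (fun z : measurableTypeR R * measurableTypeR R =>
    ((a * z.1 + b * z.2, c * z.1 + d * z.2) : measurableTypeR R * measurableTypeR R)).
  by apply/measurable_fun_pair => //=; apply: measurable_funD; exact: measurable_funM.
have := mf measurableT (`[l1, l2]%classic `*` `[m1, m2]%classic)
  (measurableX (measurable_itv _) (measurable_itv _)).
by rewrite setTI; congr measurable.
Qed.

(** With $D = ad - b^2$, the symmetric matrix with rows $(a,b)$ and $(b,d)$ is the diagonal map $(a,
    D/a)$ preceded by a shear in each variable. Shears preserve area, so only a rectangle remains to
    be measured. *)
Lemma lam2_parallelogram (a b d l1 l2 m1 m2 : R) :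
  0 < a -> 0 < a * d - b ^+ 2 -> l1 <= l2 -> m1 <= m2 ->
  lam2 [set z | l1 <= a * z.1 + b * z.2 <= l2 /\ m1 <= b * z.1 + d * z.2 <= m2]
  = ((l2 - l1) * (m2 - m1) / (a * d - b ^+ 2))%:E.
Proof.
move=> a0 D0 l12 m12; set D := a * d - b ^+ 2.
pose S : set (R * R) := [set z | l1 <= a * z.1 <= l2 /\
   m1 <= b * z.1 + (D / a) * z.2 <= m2].
pose T : set (R * R) := `[l1 / a, l2 / a]%classic `*` `[m1 * a / D, m2 * a / D]%classic.
have Da0 : 0 < D / a by rewrite divr_gt0.
have mT : measurable (T : set (measurableTypeR R * measurableTypeR R)).
  by apply: measurableX; exact: measurable_itv.
have ST : S = [set z | T (z.1, z.2 + (a * b / D) * z.1)].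
  apply/seteqP; split => z; rewrite /S /T /= !in_itv /=.
  - move=> [h1 h2]; split.
      by rewrite ler_pdivrMr // ler_pdivlMr // mulrC.
    have e : z.2 + a * b / D * z.1 = (b * z.1 + D / a * z.2) * a / D.
      by field; rewrite !gt_eqF.
    rewrite e; case/andP: h2 => h2 h3; apply/andP; split.
      by rewrite !ler_pM2r ?invr_gt0.
    by rewrite !ler_pM2r ?invr_gt0.
  - move=> [h1 h2]; split.
      by move: h1; rewrite ler_pdivrMr // ler_pdivlMr // mulrC.
    have e : z.2 + a * b / D * z.1 = (b * z.1 + D / a * z.2) * a / D.
      by field; rewrite !gt_eqF.
    by move: h2; rewrite e !ler_pM2r ?invr_gt0.
have mS : measurable (S : set (measurableTypeR R * measurableTypeR R)).
  rewrite ST.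
  have mf : measurable_fun setT (fun z : measurableTypeR R * measurableTypeR R =>
      ((z.1, z.2 + (a * b / D) * z.1) : measurableTypeR R * measurableTypeR R)).
    apply/measurable_fun_pair => //=.
    by apply: measurable_funD => //; apply: measurable_funM.
  by rewrite -[X in measurable X]setTI; exact: mf.
transitivity (lam2 [set z | S (z.1 + (b / a) * z.2, z.2)]).
  congr (lam2 _); apply/seteqP; split => z; rewrite /S /=.
  - have -> : a * (z.1 + b / a * z.2) = a * z.1 + b * z.2 by field; rewrite gt_eqF.
    have -> // : b * (z.1 + b / a * z.2) + D / a * z.2 = b * z.1 + d * z.2.
    by rewrite /D; field; rewrite gt_eqF.
  - have -> : a * (z.1 + b / a * z.2) = a * z.1 + b * z.2 by field; rewrite gt_eqF.
    have -> // : b * (z.1 + b / a * z.2) + D / a * z.2 = b * z.1 + d * z.2.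
    by rewrite /D; field; rewrite gt_eqF.
rewrite lam2_shear_x // ST lam2_shear_y // lam2_rectangle.
- by congr (_%:E); field; rewrite !gt_eqF.
- by rewrite ler_pM2r ?invr_gt0.
- by rewrite -!mulrA ler_wpM2r // ltW // divr_gt0.
Qed.

End PlaneMeasure.

(** * The measure $(1+p^2+q^2)^{-3/2}\,dp\,dq$ of rectangles *)

Section SolidAngle.
Variable R : realType.

(** Density, in gradient coordinates, of the solid angle swept by the normals of a graph. The power
    $3/2$ is split as $S\sqrt{S}$ to keep the derivative computations algebraic; [powR_3half] makes
    the link. *)
Definition dens (p q : R) : R :=
  ((1 + p ^+ 2 + q ^+ 2) * Num.sqrt (1 + p ^+ 2 + q ^+ 2))^-1.

Definition angle_prim (p q : R) : R := atan (p * q / Num.sqrt (1 + p ^+ 2 + q ^+ 2)).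

Definition angle_rect (a b c d : R) : R :=
  angle_prim b d - angle_prim a d - angle_prim b c + angle_prim a c.

Lemma sqS_gt0 (p q : R) : 0 < 1 + p ^+ 2 + q ^+ 2.
Proof. by rewrite -addrA ltr_wpDr // addr_ge0 // sqr_ge0. Qed.

Lemma dens_gt0 p q : 0 < dens p q.
Proof. by rewrite invr_gt0 mulr_gt0 ?sqrtr_gt0 ?sqS_gt0. Qed.

Lemma dens_continuous (z : R * R) : {for z, continuous (fun z => dens z.1 z.2)}.
Proof.
have cS : {for z, continuous (fun z : R * R => 1 + z.1 ^+ 2 + z.2 ^+ 2)}.
  apply: continuousD; first apply: continuousD; first exact: cst_continuous.
    apply: (@continuous_comp _ _ _ fst (fun x : R => x ^+ 2)); first exact: cvg_fst.
    exact: exprn_continuous.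
  apply: (@continuous_comp _ _ _ snd (fun x : R => x ^+ 2)); first exact: cvg_snd.
  exact: exprn_continuous.
apply: continuousV; first by rewrite gt_eqF // mulr_gt0 ?sqrtr_gt0 ?sqS_gt0.
apply: continuousM => //.
exact: (continuous_comp cS (@sqrt_continuous R _)).
Qed.

Let rad (p q : R) : R := Num.sqrt (1 + p ^+ 2 + q ^+ 2).

Let rad_gt0 p q : 0 < rad p q.
Proof. by rewrite sqrtr_gt0 sqS_gt0. Qed.

Let rad2 p q : rad p q ^+ 2 = 1 + p ^+ 2 + q ^+ 2.
Proof. by rewrite sqr_sqrtr // ltW // sqS_gt0. Qed.

Let radC p q : rad p q = rad q p.
Proof. by rewrite /rad -!addrA [p ^+ 2 + _]addrC. Qed.

Let is_derive_rad (q p : R) : is_derive p 1 (rad ^~ q) (p / rad p q).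
Proof.
have dS : is_derive p 1 (fun p : R => 1 + p ^+ 2 + q ^+ 2) (2 * p).
  by apply: is_derive_eq; rewrite /GRing.scale /=; ring.
have h := @is_derive1_comp _ Num.sqrt (fun p : R => 1 + p ^+ 2 + q ^+ 2) p _ _
   (is_derive1_sqrt (sqS_gt0 p q)) dS.
have -> : p / rad p q = (2 * p) * (2 * rad p q)^-1 by field; rewrite gt_eqF.
have -> : (rad ^~ q) = Num.sqrt \o (fun p : R => 1 + p ^+ 2 + q ^+ 2) by [].
by apply: (is_derive_eq h); rewrite mulrC.
Qed.

Let is_derive_radV (q p : R) :
  is_derive p 1 (fun p => (rad p q)^-1) (- p / rad p q ^+ 3).
Proof.
have r0 : rad p q != 0 by rewrite gt_eqF.
have := @is_deriveV _ (rad ^~ q) p _ 1 r0 (is_derive_rad q p).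
move=> h; apply: (is_derive_eq h); rewrite /GRing.scale /=.
by field.
Qed.

Definition angle_prim_dp (p q : R) : R :=
  q / ((1 + p ^+ 2) * Num.sqrt (1 + p ^+ 2 + q ^+ 2)).

Lemma is_derive_angle_prim (q p : R) :
  is_derive p 1 (angle_prim ^~ q) (angle_prim_dp p q).
Proof.
have d1 : is_derive p 1 (fun p => (p * q) * (rad p q)^-1)
    (q / rad p q + p * q * (- p / rad p q ^+ 3)).
  have h : is_derive p 1 (fun p : R => p * q) q.
    by apply: is_derive_eq; rewrite /GRing.scale /=; ring.
  apply: (is_derive_eq (is_deriveM h (is_derive_radV q p))).
  by rewrite /GRing.scale /=; ring.
apply: (is_derive_eq (is_derive1_comp (is_derive1_atan _) d1)).
have r0 : rad p q != 0 by rewrite gt_eqF.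
have p0 : 1 + p ^+ 2 != 0 by rewrite gt_eqF // ltr_wpDr // sqr_ge0.
have q0 : 1 + q ^+ 2 != 0 by rewrite gt_eqF // ltr_wpDr // sqr_ge0.
rewrite /angle_prim_dp -/(rad p q).
have -> : 1 + (p * q / rad p q) ^+ 2 = (1 + p ^+ 2) * (1 + q ^+ 2) / rad p q ^+ 2.
  have -> : (1 + p ^+ 2) * (1 + q ^+ 2) = rad p q ^+ 2 + (p * q) ^+ 2.
    by rewrite rad2; ring.
  by field.
have -> : q / rad p q + p * q * (- p / rad p q ^+ 3) = q * (1 + q ^+ 2) / rad p q ^+ 3.
  have -> : 1 + q ^+ 2 = rad p q ^+ 2 - p ^+ 2 by rewrite rad2; ring.
  by field.
by rewrite /GRing.scale /=; field; rewrite r0 p0 q0.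
Qed.

Lemma is_derive_angle_prim_dp (p q : R) :
  is_derive q 1 (angle_prim_dp p) (dens p q).
Proof.
have r0 : rad p q != 0 by rewrite gt_eqF.
have p0 : 1 + p ^+ 2 != 0 by rewrite gt_eqF // ltr_wpDr // sqr_ge0.
have dV : is_derive q 1 (fun q => (rad p q)^-1) (- q / rad p q ^+ 3).
  rewrite radC (_ : (fun q => (rad p q)^-1) = (fun q => (rad q p)^-1)) //.
  by apply/funext => x; rewrite radC.
have h : is_derive q 1 (fun q : R => (1 + p ^+ 2)^-1 * q) (1 + p ^+ 2)^-1.
  by apply: is_derive_eq; rewrite /GRing.scale /=; ring.
have -> : angle_prim_dp p = (fun q : R => (1 + p ^+ 2)^-1 * q * (rad p q)^-1).
  by apply/funext => x; rewrite /angle_prim_dp -/(rad p x) invfM; ring.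
apply: (is_derive_eq (is_deriveM h dV)).
rewrite /GRing.scale /= /dens -/(rad p q) -rad2.
have e : 1 + p ^+ 2 = rad p q ^+ 2 - q ^+ 2 by rewrite rad2; ring.
have p1 : rad p q ^+ 2 - q ^+ 2 != 0 by rewrite -e.
by rewrite e; field; rewrite r0 p1.
Qed.

(** The mean value theorem, once in $p$ and once in $q$. It stands in for the integral of [dens]:
    every comparison between the mass of a rectangle and the density passes through an intermediate
    point. *)
Lemma angle_rectE (a b c d : R) : a < b -> c < d ->
  exists s t, [/\ a <= s <= b, c <= t <= d &
    angle_rect a b c d = (b - a) * (d - c) * dens s t].
Proof.
move=> ab cd.
pose f p := angle_prim p d - angle_prim p c.
have df (p : R) : is_derive p 1 f (angle_prim_dp p d - angle_prim_dp p c).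
  by apply: is_deriveB; exact: is_derive_angle_prim.
have [s sab fs] := @MVT R f _ a b ab (fun x _ => df x)
  (@derivable_within_continuous R _ f `[a, b] (fun x _ => @ex_derive _ _ _ _ _ _ _ (df x))).
have dg (q : R) := is_derive_angle_prim_dp s q.
have [t tcd gt] := @MVT R _ _ c d cd (fun x _ => dg x)
  (@derivable_within_continuous R _ _ `[c, d] (fun x _ => @ex_derive _ _ _ _ _ _ _ (dg x))).
move: sab tcd; rewrite !in_itv /= => /andP[s1 s2] /andP[t1 t2].
exists s, t; split; [by rewrite !ltW | by rewrite !ltW|].
have -> : angle_rect a b c d = f b - f a by rewrite /f /angle_rect; ring.
by rewrite fs gt; ring.
Qed.

Lemma angle_rect_addx (a b e c d : R) :
  angle_rect a b c d + angle_rect b e c d = angle_rect a e c d.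
Proof. by rewrite /angle_rect; lra. Qed.

Lemma angle_rect_addy (a b c e d : R) :
  angle_rect a b c e + angle_rect a b e d = angle_rect a b c d.
Proof. by rewrite /angle_rect; lra. Qed.

Lemma angle_rect_gt0 (a b c d : R) : a < b -> c < d -> 0 < angle_rect a b c d.
Proof.
move=> ab cd; have [s [t [_ _ ->]]] := @angle_rectE _ _ _ _ ab cd.
by rewrite !mulr_gt0 ?subr_gt0 ?dens_gt0.
Qed.

(** Four arctangents, each below $\pi/2$ in absolute value. The constant is the total mass of the
    plane, so it can be compared with $K\mathcal{A}(\Omega)$ without loss. *)
Lemma angle_rect_le2pi (a b c d : R) : angle_rect a b c d <= 2 * pi.
Proof.
rewrite /angle_rect /angle_prim.
have u := @atan_ltpi2 R; have l := @atan_gtNpi2 R.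
set x1 := (X in atan X - _ - _ + _); set x2 := (X in _ - atan X - _ + _).
set x3 := (X in _ - _ - atan X + _); set x4 := (X in _ - _ - _ + atan X).
have := u x1; have := u x4; have := l x2; have := l x3; lra.
Qed.

(** The $p$-derivative of the primitive at $q = n$ is at most $1/(1+p^2) \le p^{-2}$, the derivative
    of $-1/p$. The bound does not depend on $n$, so it extends to an infinite strip. *)
Lemma angle_rect_strip_le (t n : R) : 0 < t -> t < n ->
  angle_rect t n 0 n <= t^-1.
Proof.
move=> t0 tn; have n0 := lt_trans t0 tn.
have -> : angle_rect t n 0 n = angle_prim n n - angle_prim t n.
  by rewrite /angle_rect /angle_prim !mulr0 !mul0r atan0; ring.
pose f p : R := - p^-1 - angle_prim p n.
have df (p : R) : 0 < p -> is_derive p 1 f (p ^- 2 - angle_prim_dp p n).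
  move=> p0; apply: is_deriveB; last exact: is_derive_angle_prim.
  have pn : id p != 0 by rewrite gt_eqF.
  apply: (is_derive_eq (is_deriveN (@is_deriveV _ id p _ 1 pn (is_derive_id _ _)))).
  by rewrite /GRing.scale /= mulr1 opprK.
have po (x : R) : x \in `]t, n[ -> 0 < x.
  by move=> xtn; rewrite (lt_trans t0) // (itvP xtn).
have pc (x : R) : x \in `[t, n] -> 0 < x.
  by move=> xtn; rewrite (lt_le_trans t0) // (itvP xtn).
have [x xtn fx] := @MVT R f _ t n tn (fun x hx => df x (po x hx))
  (@derivable_within_continuous R _ f `[t, n] (fun x hx =>
     @ex_derive _ _ _ _ _ _ _ (df x (pc x hx)))).
have x0 : 0 < x by rewrite (lt_trans t0) // (itvP xtn).
have : 0 <= f n - f t.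
  rewrite fx mulr_ge0 ?subr_ge0 ?(ltW tn) //.
  have r0 := rad_gt0 x n.
  have nr : n <= rad x n.
    rewrite /rad -{1}[n](ger0_norm (ltW n0)) -sqrtr_sqr; apply: ler_wsqrtr.
    by rewrite ler_wpDl // addr_ge0 // sqr_ge0.
  rewrite /angle_prim_dp -/(rad x n) invfM mulrA mulrAC.
  apply: (@le_trans _ _ (1 * (1 + x ^+ 2)^-1)).
    by rewrite ler_wpM2r ?invr_ge0 ?addr_ge0 ?sqr_ge0 // ler_pdivrMr // mul1r.
  by rewrite mul1r lef_pV2 ?posrE ?exprn_gt0 ?ltr_wpDr ?sqr_ge0 // lerDr.
rewrite /f; have : 0 < n^-1 by rewrite invr_gt0.
lra.
Qed.

(** The density is at most $T^{-3}$ where $q \ge T$; this cubic decay makes the high layers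
    small. *)
Lemma angle_rect_slab_le (L T U : R) : 0 < L -> 0 < T -> T < U ->
  angle_rect 0 L T U <= L * (U - T) / T ^+ 3.
Proof.
move=> L0 T0 TU; have [s [t [_ /andP[Tt _] ->]]] := @angle_rectE _ _ _ _ L0 TU.
rewrite subr0 ler_wpM2l ?mulr_ge0 ?subr_ge0 ?(ltW L0) ?(ltW TU) //.
have t0 := lt_le_trans T0 Tt.
have TS : T ^+ 2 <= 1 + s ^+ 2 + t ^+ 2.
  apply: (@le_trans _ _ (t ^+ 2)); first by rewrite ler_pXn2r ?nnegrE ?(ltW T0) ?(ltW t0).
  by rewrite lerDr addr_ge0 // sqr_ge0.
rewrite /dens lef_pV2 ?posrE ?exprn_gt0 ?mulr_gt0 ?sqrtr_gt0 ?sqS_gt0 //.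
rewrite exprSr ler_pM ?exprn_ge0 ?(ltW T0) //.
by rewrite -[T](ger0_norm (ltW T0)) -sqrtr_sqr; apply: ler_wsqrtr.
Qed.

(** * Bisection for additive rectangle functions *)

Section Bisection.
Variables (F : R -> R -> R -> R -> R) (w h : R).
Hypotheses (w0 : 0 < w) (h0 : 0 < h).
Hypothesis addx : forall a b e c d, a <= b -> b <= e ->
  F a b c d + F b e c d = F a e c d.
Hypothesis addy : forall a b c e d, c <= e -> e <= d ->
  F a b c e + F a b e d = F a b c d.
Hypothesis locF : forall p q, exists2 r0, 0 < r0 & forall r, 0 < r < r0 ->
  forall x y, x <= p <= x + w * r -> y <= q <= y + h * r ->
  0 <= F x (x + w * r) y (y + h * r).

Let neg r (z : R * R) := F z.1 (z.1 + w * r) z.2 (z.2 + h * r) < 0.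

(** Selects a quarter on which [F] is negative. The last quarter is the default: by additivity it is
    negative when the other three are not. *)
Let step r (z : R * R) : R * R :=
  if neg r z then z else
  if neg r (z.1 + w * r, z.2) then (z.1 + w * r, z.2) else
  if neg r (z.1, z.2 + h * r) then (z.1, z.2 + h * r) else
  (z.1 + w * r, z.2 + h * r).

Let stepP r z : 0 < r -> neg (r + r) z ->
  [/\ neg r (step r z), z.1 <= (step r z).1, z.2 <= (step r z).2,
   (step r z).1 + w * r <= z.1 + w * (r + r) &
   (step r z).2 + h * r <= z.2 + h * (r + r)].
Proof.
move=> r0 n2.
have wr : 0 < w * r by rewrite mulr_gt0.
have hr : 0 < h * r by rewrite mulr_gt0.
have n4 : [\/ neg r z, neg r (z.1 + w * r, z.2), neg r (z.1, z.2 + h * r) |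
           neg r (z.1 + w * r, z.2 + h * r)].
  move: n2; rewrite /neg /= !mulrDr !addrA.
  rewrite -(@addx z.1 (z.1 + w * r)) ?lerDl ?(ltW wr) //.
  rewrite -(@addy z.1 _ z.2 (z.2 + h * r)) ?lerDl ?(ltW hr) //.
  rewrite -(@addy (z.1 + w * r) _ z.2 (z.2 + h * r)) ?lerDl ?(ltW hr) // !addrA => n2.
  case: ltP => h1; first by constructor 1.
  case: (ltP (F (z.1 + w * r) _ z.2 _)) => h2; first by constructor 2.
  case: (ltP (F z.1 _ (z.2 + h * r) _)) => h3; first by constructor 3.
  by constructor 4; lra.
rewrite /step; case: ifP => [?|e1]; first by split => //; lra.
case: ifP => [?|e2]; first by split => //=; lra.
case: ifP => [?|e3]; first by split => //=; lra.
have : neg r (z.1 + w * r, z.2 + h * r) by case: n4; rewrite ?e1 ?e2 ?e3.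
by split => //=; lra.
Qed.

(** Goursat's argument: a negative rectangle contains a negative quarter, and so on down to a common
    point, where [locF] is contradicted. The quarters keep the proportions [w] to [h], and [locF]
    asks only that a rectangle contain the point, since nothing places it inside the quarters. *)
Lemma bisection_ge0 a c : 0 <= F a (a + w) c (c + h).
Proof.
rewrite leNgt; apply/negP => Fn.
pose z := fix z n : R * R := if n is n'.+1 then step (2^-1 ^+ n) (z n') else (a, c).
pose s n : R := 2^-1 ^+ n.
have s0 n : 0 < s n by rewrite exprn_gt0 // invr_gt0.
have sS n : s n = s n.+1 + s n.+1 by rewrite /s exprS; lra.
have zn n : neg (s n) (z n).
  elim: n => [|n IH]; first by rewrite /neg /s /= expr0 !mulr1.
  by move: IH; rewrite sS => /(stepP _ _ (s0 _))[].
have zP n : [/\ (z n).1 <= (z n.+1).1, (z n).2 <= (z n.+1).2,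
   (z n.+1).1 + w * s n.+1 <= (z n).1 + w * s n &
   (z n.+1).2 + h * s n.+1 <= (z n).2 + h * s n].
  by have := zn n; rewrite sS => /(stepP _ _ (s0 _))[].
have ndec (f : nat -> R) : (forall n, f n <= f n.+1) -> forall n m, (n <= m)%N -> f n <= f m.
  move=> fS n m /subnK <-; elim: (m - n)%N => // k IH; exact: le_trans IH (fS _).
have key (f g : nat -> R) : (forall n, f n <= f n.+1) -> (forall n, g n.+1 <= g n) ->
    (forall n, f n <= g n) -> exists p, forall n, f n <= p <= g n.
  move=> f1 g1 fg; exists (sup (range f)) => n.
  have fgnm m : f m <= g n.
    apply: (le_trans (ndec _ f1 _ _ (leq_maxl m n))); apply: (le_trans (fg _)).
    by rewrite -lerN2; apply: (ndec (fun k => - g k)) (leq_maxr _ _) => k; rewrite lerN2.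
  have ub : has_ubound (range f) by exists (g n) => _ [m _ <-].
  apply/andP; split; first by apply: ub_le_sup => //; exists n.
  by apply: ge_sup; [exists (f 0%N), 0%N | move=> _ [m _ <-]].
have [p hp] : exists p, forall n, (z n).1 <= p <= (z n).1 + w * s n.
  apply: (key (fun n => (z n).1) (fun n => (z n).1 + w * s n)) => n;
   [by case: (zP n)|by case: (zP n)|by rewrite lerDl mulr_ge0 // ltW].
have [q hq] : exists q, forall n, (z n).2 <= q <= (z n).2 + h * s n.
  apply: (key (fun n => (z n).2) (fun n => (z n).2 + h * s n)) => n;
   [by case: (zP n)|by case: (zP n)|by rewrite lerDl mulr_ge0 // ltW].
have [r0 r00 hr] := locF p q.
have [n sn] : exists n, s n < r0.
  have : (fun n => s n) @ \oo --> (0 : R).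
    by apply: cvg_expr; rewrite ger0_norm ?invr_ge0 // invf_lt1 // ltr1n.
  move=> /cvgrPdist_lt /(_ _ r00)[n _ /(_ n (leqnn n))].
  by rewrite sub0r normrN ger0_norm ?ltW //; exists n.
have := zn n; rewrite /neg ltNge; apply/negP/negPn.
by apply: hr; rewrite ?s0.
Qed.

End Bisection.
End SolidAngle.

(** * Gradient maps of prescribed curvature *)

Section CurvatureMap.
Variable R : realType.

(** The $\ell^1$ distance keeps the estimates free of square roots; a scalar product is bounded by
    the product of $\ell^1$ norms. *)
Definition dist1 (x y : R * R) : R := `|y.1 - x.1| + `|y.2 - x.2|.

Lemma dist1_near (x : R * R) (r : R) : 0 < r -> \forall y \near x, dist1 x y < r.
Proof.
move=> r0; apply/nbhs_ballP; exists (r / 2); first by rewrite /= divr_gt0.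
move=> y [/= h1 h2]; move: h1 h2; rewrite /ball /= distrC (distrC x.2) => h1 h2.
by rewrite /dist1; lra.
Qed.

Lemma measurable_fun_open (O : set (R * R)) (f : R * R -> R) :
  open O -> (forall x, O x -> {for x, continuous f}) ->
  measurable_fun (O : set (measurableTypeR R * measurableTypeR R))
    (f : measurableTypeR R * measurableTypeR R -> measurableTypeR R).
Proof.
move=> oO cf.
apply: (measurability _ (RGenOInfty.measurableE R)) => // _ [_ [a ->] <-].
apply: open_measurable_plane; rewrite openE => x [Ox /=]; rewrite in_itv /= andbT => ax.
have h1 := cvgr_gt (f x) (cf x Ox) a ax; have h2 := open_nbhs_nbhs (conj oO Ox).
rewrite /interior; apply: filterS (filterI h2 (h1 _)) => y [] Oy ay.
by split => //=; rewrite in_itv /= andbT.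
Qed.

Variables (O : set (R * R)) (K : R) (p q : R * R -> R).

(** Differentiability of $(p,q)$ with a symmetric Jacobian; the determinant condition is the
    curvature equation, and $a > 0$ then makes the Jacobian positive definite. *)
Definition expansion_at (x : R * R) := exists a b d, [/\ 0 < a,
  a * d - b ^+ 2 = K / dens _ (p x) (q x) &
  forall e, 0 < e -> exists2 r, 0 < r & forall y, O y -> dist1 x y < r ->
   `|p y - p x - (a * (y.1 - x.1) + b * (y.2 - x.2))| <= e * dist1 x y /\
   `|q y - q x - (b * (y.1 - x.1) + d * (y.2 - x.2))| <= e * dist1 x y].

Definition dotdiff (x y : R * R) : R :=
  (p y - p x) * (y.1 - x.1) + (q y - q x) * (y.2 - x.2).

(** Closedness of the image of [O], in the pointwise dichotomy in which it is used. *)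
Definition closed_range := forall s t, (exists2 x, O x & p x = s /\ q x = t) \/
  exists2 e, 0 < e & forall x, O x -> e <= `|p x - s| + `|q x - t|.

Definition curvature_map := [/\ forall x, O x -> expansion_at x,
  forall x y, O x -> O y -> 0 <= dotdiff x y & closed_range].

Hypotheses (oO : open O) (K0 : 0 < K)
  (cO : forall x y t, O x -> O y -> 0 <= t <= 1 -> O (t *: x + (1 - t) *: y))
  (cm : curvature_map).

Let expO := let: And3 h _ _ := cm in h.
Let monO := let: And3 _ h _ := cm in h.
Let closedO := let: And3 _ _ h := cm in h.

Lemma curvature_map_continuous x : O x ->
  {for x, continuous p} /\ {for x, continuous q}.
Proof.
move=> Ox; have [a [b [d [_ _ /(_ 1 ltr01)[r r0 hr]]]]] := expO _ Ox.
have key (f : R * R -> R) (a' b' : R) : (forall y, O y -> dist1 x y < r ->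
    `|f y - f x - (a' * (y.1 - x.1) + b' * (y.2 - x.2))| <= 1 * dist1 x y) ->
    {for x, continuous f}.
  move=> hf; apply/cvgrPdist_lt => e e0.
  pose C := `|a'| + `|b'| + 1.
  have C0 : 0 < C by rewrite ltr_wpDl // addr_ge0.
  have h1 := @dist1_near x _ r0.
  have h2 := @dist1_near x (e / C) (divr_gt0 e0 C0).
  near=> y.
  have Oy : O y by near: y; exact: (open_nbhs_nbhs (conj oO Ox)).
  have yr : dist1 x y < r by near: y.
  have : dist1 x y < e / C by near: y.
  rewrite ltr_pdivlMr // => ye.
  rewrite distrC; have := hf y Oy yr; rewrite mul1r.
  set u := f y - f x; set h := y.1 - x.1; set k := y.2 - x.2 => hu.
  apply: le_lt_trans ye.
  have -> : u = (u - (a' * h + b' * k)) + (a' * h + b' * k) by ring.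
  apply: (le_trans (ler_normD _ _)).
  have : `|a' * h + b' * k| <= (`|a'| + `|b'|) * dist1 x y.
    apply: (le_trans (ler_normD _ _)); rewrite !normrM /dist1 -/h -/k.
    have := normr_ge0 a'; have := normr_ge0 b'; have := normr_ge0 h; have := normr_ge0 k; nra.
  by rewrite /C; lra.
split; [apply: (key _ a b)|apply: (key _ b d)] => y Oy yr; by have [] := hr y Oy yr.
Unshelve. all: by end_near. Qed.

(** Close to [x] the positive definite Jacobian gives quadratic growth; farther away monotonicity
    along segments keeps linear growth. Hence points whose image is close to that of [x] are close
    to [x]. *)
Lemma curvature_map_coercive x : O x -> exists c r, [/\ 0 < c, 0 < r &
  forall y, O y ->
    (dist1 x y <= r -> c * dist1 x y ^+ 2 <= dotdiff x y) /\
    (r <= dist1 x y -> c * r * dist1 x y <= dotdiff x y)].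
Proof.
move=> Ox; have [a [b [d [a0 Dd he]]]] := expO _ Ox.
have D0 : 0 < a * d - b ^+ 2 by rewrite Dd divr_gt0 // dens_gt0.
have d0 : 0 < d by rewrite -(pmulr_rgt0 _ a0); have := sqr_ge0 b; lra.
(* The least eigenvalue of a positive definite form is at least determinant over trace; the factor 2
   passes from the Euclidean norm to [dist1]. *)
pose c0 := (a * d - b ^+ 2) / (2 * (a + d)).
have c00 : 0 < c0 by rewrite divr_gt0 // mulr_gt0 // addr_gt0.
have [r r0 hr] := he (c0 / 2) ltac:(by rewrite divr_gt0).
have c20 : 0 < c0 / 2 by rewrite divr_gt0.
have r20 : 0 < r / 2 by rewrite divr_gt0.
have near_ y : O y -> dist1 x y <= r / 2 -> c0 / 2 * dist1 x y ^+ 2 <= dotdiff x y.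
  move=> Oy yr; have [] := hr y Oy ltac:(by lra); rewrite /dotdiff.
  set h := y.1 - x.1; set k := y.2 - x.2; set m := dist1 x y.
  set u := p y - p x; set v := q y - q x => hu hv.
  have mE : m = `|h| + `|k| by [].
  have Q : c0 * m ^+ 2 <= a * h ^+ 2 + 2 * b * h * k + d * k ^+ 2.
    have m2 : m ^+ 2 <= 2 * (h ^+ 2 + k ^+ 2).
      rewrite mE -[h ^+ 2]real_normK ?num_real // -[k ^+ 2]real_normK ?num_real //.
      by have := sqr_ge0 (`|h| - `|k|); nra.
    have e1 : (a + d) * (a * h ^+ 2 + 2 * b * h * k + d * k ^+ 2) =
       (a * d - b ^+ 2) * (h ^+ 2 + k ^+ 2) + ((a * h + b * k) ^+ 2 + (b * h + d * k) ^+ 2).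
      by ring.
    have ad0 : 0 < a + d by rewrite addr_gt0.
    rewrite -(ler_pM2l ad0) e1.
    have -> : (a + d) * (c0 * m ^+ 2) = (a * d - b ^+ 2) * (m ^+ 2 / 2).
      by rewrite /c0; field; rewrite gt_eqF.
    apply: (@le_trans _ _ ((a * d - b ^+ 2) * (h ^+ 2 + k ^+ 2))).
      by rewrite ler_pM2l //; lra.
    by rewrite lerDl addr_ge0 // sqr_ge0.
  have E (w z : R) : `|w| <= c0 / 2 * m -> - (c0 / 2 * m * `|z|) <= w * z.
    move=> hw; rewrite lerNl -mulNr; apply: (le_trans (ler_norm _)).
    by rewrite normrM normrN ler_wpM2r.
  have e1 := E _ h hu; have e2 := E _ k hv.
  have e3 : c0 / 2 * m * `|h| + c0 / 2 * m * `|k| = c0 / 2 * m ^+ 2.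
    by rewrite -mulrDr -mE -mulrA expr2.
  lra.
exists (c0 / 2), (r / 2); split => // y Oy; split; first exact: near_.
rewrite le_eqVlt => /orP[/eqP e|ym].
  by rewrite {1}e -mulrA -expr2; apply: near_ => //; rewrite e.
set m := dist1 x y in ym *; set s := r / 2 in r20 ym near_ *.
have m0 : 0 < m := lt_trans r20 ym.
(* [z] is the point of the segment at distance exactly [s] from [x]. The quadratic bound holds
   there, and monotonicity between [z] and [y] carries it outward. *)
pose t := s / m.
have t0 : 0 < t by rewrite divr_gt0.
have t1 : t < 1 by rewrite ltr_pdivrMr // mul1r.
pose z := t *: y + (1 - t) *: x.
have Oz : O z by apply: cO => //; rewrite !ltW.
have z1 : z.1 - x.1 = t * (y.1 - x.1) by rewrite /z /= /GRing.scale /=; ring.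
have z2 : z.2 - x.2 = t * (y.2 - x.2) by rewrite /z /= /GRing.scale /=; ring.
have zx : dist1 x z = s.
  rewrite /dist1 z1 z2 !(normrM t) -mulrDr (ger0_norm (ltW t0)).
  by apply: divfK; rewrite gt_eqF.
have h1 := near_ z Oz ltac:(by rewrite zx).
have h2 := monO _ _ Oz Oy.
have yz1 : y.1 - z.1 = (1 - t) * (y.1 - x.1) by rewrite /z /= /GRing.scale /=; ring.
have yz2 : y.2 - z.2 = (1 - t) * (y.2 - x.2) by rewrite /z /= /GRing.scale /=; ring.
move: h1 h2; rewrite /dotdiff z1 z2 yz1 yz2 zx.
set h := y.1 - x.1; set k := y.2 - x.2 => h1 h2.
have h3 : 0 <= (p y - p z) * h + (q y - q z) * k.
  by rewrite -(pmulr_rge0 _ (_ : 0 < 1 - t)) ?subr_gt0 //; lra.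
have h4 : c0 / 2 * s * m <= (p z - p x) * h + (q z - q x) * k.
  rewrite -(ler_pM2l t0).
  have -> : t * (c0 / 2 * s * m) = c0 / 2 * s ^+ 2.
    by rewrite /t; field; rewrite gt_eqF.
  lra.
lra.
Qed.

Lemma curvature_map_strict x y : O x -> O y -> x != y -> 0 < dotdiff x y.
Proof.
move=> Ox Oy xy; have [c [r [c0 r0 /(_ _ Oy)[h1 h2]]]] := curvature_map_coercive _ Ox.
have m0 : 0 < dist1 x y.
  rewrite lt_neqAle addr_ge0 // andbT eq_sym paddr_eq0 // !normr_eq0 !subr_eq0.
  by apply: contra xy; case: x y {Ox Oy h1 h2} => [? ?] [? ?] /= /andP[/eqP -> /eqP ->].
have [yr|yr] := leP (dist1 x y) r.
  by apply: lt_le_trans (h1 yr); rewrite mulr_gt0 // exprn_gt0.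
by apply: lt_le_trans (h2 (ltW yr)); rewrite !mulr_gt0.
Qed.

End CurvatureMap.

(** * Area of the preimage of a rectangle *)

Lemma dist_itv_le (R : realType) (X A s z : R) :
  X <= s <= X + A -> X < z <= X + A -> `|z - s| <= A.
Proof. by rewrite ler_norml; lra. Qed.

Lemma dist_lt_itv (R : realType) (X A u v r : R) :
  A < r -> X <= u <= X + A -> X <= v <= X + A -> `|u - v| < r.
Proof. by rewrite ltr_norml; lra. Qed.

Lemma pad_le (R : realType) (f w y : R) :
  y <= f / 6 * w -> w + 2 * y <= w * (1 + f / 3).
Proof. by lra. Qed.

Lemma dot_le_norm1 (R : realType) (u v h k : R) :
  u * h + v * k <= (`|u| + `|v|) * (`|h| + `|k|).
Proof.
apply: (le_trans (ler_norm _)); apply: (le_trans (ler_normD _ _)).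
rewrite !normrM !mulrDl !mulrDr.
have h1 : 0 <= `|u| * `|k| by rewrite mulr_ge0.
have h2 : 0 <= `|v| * `|h| by rewrite mulr_ge0.
lra.
Qed.

Lemma shift_itv_le (R : realType) (X A s z t e c : R) :
  X < z <= X + A -> `|z - s - t| <= e ->
  X - s - e + c <= t + c <= X + A - s + e + c.
Proof. by rewrite ler_norml; lra. Qed.

Section CurvatureMass.
Variable R : realType.
Local Notation plane := (measurableTypeR R * measurableTypeR R)%type.
Variables (O : set (R * R)) (K : R) (p q : R * R -> R).
Hypotheses (oO : open O) (K0 : 0 < K)
  (cO : forall x y t, O x -> O y -> 0 <= t <= 1 -> O (t *: x + (1 - t) *: y))
  (finO : (lam2 O < +oo)%E)
  (cm : curvature_map R O K p q).

Let coercive x Ox := curvature_map_coercive R O K p q K0 cO cm x Ox.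
Let closedO := let: And3 _ _ h := cm in h.
Let expO := let: And3 h _ _ := cm in h.

(** Half-open rectangles make adjacent boxes disjoint, so [mass] is exactly additive. *)
Definition box (a b c d : R) : set plane :=
  O `&` [set z | a < p z <= b /\ c < q z <= d].

Definition mass (a b c d : R) : R := fine (lam2 (box a b c d)).

Let mp : measurable_fun (O : set plane) (p : plane -> measurableTypeR R).
Proof.
apply: measurable_fun_open => // x Ox.
by have [] := curvature_map_continuous R O K p q oO cm x Ox.
Qed.

Let mq : measurable_fun (O : set plane) (q : plane -> measurableTypeR R).
Proof.
apply: measurable_fun_open => // x Ox.
by have [] := curvature_map_continuous R O K p q oO cm x Ox.
Qed.

Let mO : measurable (O : set plane).
Proof. exact: open_measurable_plane. Qed.

(** The maps are controlled on [O] only; they are extended by zero to the plane and the result is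
    cut back to [O]. *)
Lemma measurable_preimage_map (V : set plane) : measurable V ->
  measurable (O `&` [set z | V (p z, q z)] : set plane).
Proof.
move=> mV.
have mf : measurable_fun setT (fun z : plane => ((p \_ O) z, (q \_ O) z) : plane).
  by apply/measurable_fun_pair; exact/(measurable_restrictT _ mO).
have := measurableI _ _ mO (mf measurableT V mV); rewrite setTI; congr measurable.
apply/seteqP; split => z /= [Oz]; rewrite /patch mem_set //.
Qed.

Lemma measurable_box a b c d : measurable (box a b c d).
Proof.
have := measurable_preimage_map (`]a, b]%classic `*` `]c, d]%classic)
  (measurableX (measurable_itv _) (measurable_itv _)).
by congr measurable.
Qed.

Lemma lam2_fin (A : set plane) : measurable A -> A `<=` O -> lam2 A \is a fin_num.
Proof.
move=> mA AO; rewrite ge0_fin_numE //; apply: le_lt_trans finO.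
by apply: le_measure => //; rewrite inE.
Qed.

Lemma box_fin a b c d : lam2 (box a b c d) \is a fin_num.
Proof. by apply: lam2_fin; [exact: measurable_box | move=> z []]. Qed.

Lemma mass_addx a b e c d : a <= b -> b <= e ->
  mass a b c d + mass b e c d = mass a e c d.
Proof.
move=> ab be; rewrite /mass -fineD ?box_fin //.
congr fine; rewrite -measureU; try exact: measurable_box.
- congr (lam2 _); apply/seteqP; split => z; rewrite /box /=.
    by case => -[Oz [h1 h2]]; split => //; split => //; lra.
  case=> Oz [h1 h2]; case: (leP (p z) b) => h3; [left|right]; split => //; split => //; lra.
- by apply/seteqP; split => z //; rewrite /box /=; case=> -[_ [h1 _]] [_ [h2 _]]; lra.
Qed.

Lemma mass_addy a b c e d : c <= e -> e <= d ->
  mass a b c e + mass a b e d = mass a b c d.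
Proof.
move=> ce ed; rewrite /mass -fineD ?box_fin //.
congr fine; rewrite -measureU; try exact: measurable_box.
- congr (lam2 _); apply/seteqP; split => z; rewrite /box /=.
    by case => -[Oz [h1 h2]]; split => //; split => //; lra.
  case=> Oz [h1 h2]; case: (leP (q z) e) => h3; [left|right]; split => //; split => //; lra.
- by apply/seteqP; split => z //; rewrite /box /=; case=> -[_ [_ h1]] [_ [_ h2]]; lra.
Qed.

(** By coercivity a point of the box is within a multiple of [r] of [x], where the error of the
    expansion is at most [eta * r]. So the linear part sends it into the rectangle widened by
    [eta * r] on each side. *)
Lemma box_sub_parallelogram x eta w h : O x -> 0 < eta -> 0 < w -> 0 < h ->
  exists a b d, [/\ 0 < a, a * d - b ^+ 2 = K / dens R (p x) (q x) &
    exists2 r0, 0 < r0 & forall r, 0 < r < r0 -> forall X Y,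
      X <= p x <= X + w * r -> Y <= q x <= Y + h * r ->
      box X (X + w * r) Y (Y + h * r) `<=`
      [set z | X - p x - eta * r + (a * x.1 + b * x.2) <= a * z.1 + b * z.2 <=
               X + w * r - p x + eta * r + (a * x.1 + b * x.2) /\
               Y - q x - eta * r + (b * x.1 + d * x.2) <= b * z.1 + d * z.2 <=
               Y + h * r - q x + eta * r + (b * x.1 + d * x.2)]].
Proof.
move=> Ox eta0 w0 h0; have wh0 : 0 < w + h by rewrite addr_gt0.
have [c [rho [c0 rho0 hco]]] := coercive x Ox.
have [a [b [d [a0 Dd hex]]]] := expO x Ox.
exists a, b, d; split => //.
(* Points of the box satisfy $|z - x| \le (w+h)r/c$, so this relative error amounts to at most
   [eta * r]. *)
have [r1 r10 hr1] := hex _ (divr_gt0 (mulr_gt0 eta0 c0) wh0).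
(* The first bound excludes the linear regime of coercivity, the second brings the box inside the
   radius of the expansion. *)
exists (Num.min (c * rho) (c * r1) / (w + h)).
  by rewrite divr_gt0 // lt_min !mulr_gt0.
move=> r /andP[rp]; rewrite ltr_pdivlMr // lt_min => /andP[k1 k2] X Y Xs Yt.
move=> z [Oz /= [zp zq]].
have [n1 n2] := hco z Oz.
set m := dist1 R x z in n1 n2.
have m0 : 0 <= m by rewrite addr_ge0.
pose N := `|p z - p x| + `|q z - q x|.
have Nr : N <= r * (w + h).
  by rewrite mulrDr; apply: lerD; rewrite mulrC; [exact: dist_itv_le Xs zp|exact: dist_itv_le Yt zq].
have dN : dotdiff R p q x z <= N * m by exact: dot_le_norm1.
have mr : c * m <= N.
  have [->|mn0] := eqVneq m 0; first by rewrite mulr0 addr_ge0.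
  have mp0 : 0 < m by rewrite lt_neqAle eq_sym mn0.
  have [mrho|mrho] := leP m rho.
    by rewrite -(ler_pM2r mp0) -mulrA -expr2; apply: le_trans (n1 mrho) dN.
  have : c * rho <= N.
    by rewrite -(ler_pM2r mp0); apply: le_trans (n2 (ltW mrho)) dN.
  by move=> h1; have := lt_le_trans k1 (le_trans h1 Nr); rewrite ltxx.
have cmr := le_trans mr Nr.
have mr1 : m < r1 by rewrite -(ltr_pM2l c0); exact: le_lt_trans cmr k2.
have [e2 e3] := hr1 z Oz mr1.
have bd : eta * c / (w + h) * m <= eta * r.
  have -> : eta * c / (w + h) * m = eta * (c * m / (w + h)).
    by field; rewrite gt_eqF.
  by rewrite ler_pM2l // ler_pdivrMr.
have e4 := shift_itv_le _ _ _ _ _ _ _ (a * x.1 + b * x.2) zp (le_trans e2 bd).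
have e5 := shift_itv_le _ _ _ _ _ _ _ (b * x.1 + d * x.2) zq (le_trans e3 bd).
have ring1 (u v : R) : u * (z.1 - x.1) + v * (z.2 - x.2) + (u * x.1 + v * x.2) =
  u * z.1 + v * z.2 by ring.
by rewrite !ring1 in e4, e5.
Qed.

(** If $(s,t)$ is not attained, small boxes are empty. Otherwise the parallelogram has area close to
    $wh\,r^2$ times the density at $(s,t)$ over $K$, and continuity of the density gives the
    comparison. *)
Lemma mass_local e w h s t : 0 < e <= 1 -> 0 < w -> 0 < h ->
  exists2 r0, 0 < r0 & forall r, 0 < r < r0 -> forall X Y,
    X <= s <= X + w * r -> Y <= t <= Y + h * r ->
    K * mass X (X + w * r) Y (Y + h * r) <=
    (1 + e) * angle_rect R X (X + w * r) Y (Y + h * r).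
Proof.
move=> /andP[e0 e1] w0 h0; have wh0 : 0 < w + h by rewrite addr_gt0.
have rect0 r X Y : 0 < r ->
    0 < angle_rect R X (X + w * r) Y (Y + h * r).
  by move=> r0; apply: angle_rect_gt0; rewrite ltrDl mulr_gt0.
have [[x Ox [ps qt]]|[de de0 hde]] := closedO s t; last first.
  exists (de / (w + h)); first by rewrite divr_gt0.
  move=> r /andP[r0]; rewrite ltr_pdivlMr // => rd X Y Xs Yt.
  have -> : mass X (X + w * r) Y (Y + h * r) = 0.
    rewrite /mass (_ : box _ _ _ _ = set0) ?measure0 //.
    apply/seteqP; split => z //; rewrite /box /= => -[Oz [h1 h2]].
    have := hde z Oz; apply/negP; rewrite -ltNge; apply: le_lt_trans rd.
    by rewrite mulrDr; apply: lerD; rewrite mulrC; [exact: dist_itv_le Xs h1|exact: dist_itv_le Yt h2].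
  by rewrite mulr0; apply: mulr_ge0; [rewrite addr_ge0 ?(ltW e0)|exact/ltW/rect0].
have dst := dens_gt0 R s t.
(* Widening the rectangle and moving the density each cost a factor $1 + f$, and $(1+f)^2 \le
   1+e$. *)
pose f := e / 3; have f0 : 0 < f by rewrite divr_gt0.
have f10 : 0 < 1 + f by rewrite addr_gt0.
have fe : (1 + f) ^+ 2 <= 1 + e.
  rewrite -subr_ge0; have -> : 1 + e - (1 + f) ^+ 2 = e * (1 / 3 - e / 9).
    by rewrite /f; field.
  by rewrite mulr_ge0 ?(ltW e0) //; lra.
have f13 : (1 + f / 3) ^+ 2 <= 1 + f.
  rewrite -subr_ge0; have -> : 1 + f - (1 + f / 3) ^+ 2 = f * (1 / 3 - e / 27).
    by rewrite /f; field.
  by rewrite mulr_ge0 ?(ltW f0) //; lra.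
(* Chosen so that each widened side is at most $1 + f/3$ times the original, where $(1+f/3)^2 \le
   1+f$. *)
pose eta := f / 6 * Num.min w h.
have eta0 : 0 < eta by rewrite mulr_gt0 ?divr_gt0 // lt_min w0.
have etaw : eta <= f / 6 * w by rewrite ler_pM2l ?divr_gt0 // ge_min lexx.
have etah : eta <= f / 6 * h by rewrite ler_pM2l ?divr_gt0 // ge_min lexx orbT.
have [a [b [d [a0 Dd [r1 r10 hr1]]]]] := box_sub_parallelogram x eta w h Ox eta0 w0 h0.
rewrite ps qt in Dd hr1.
have D0 : 0 < a * d - b ^+ 2 by rewrite Dd divr_gt0.
have [r2 /= r20 hr2] : exists2 r2, 0 < r2 & forall z, `|s - z.1| < r2 -> `|t - z.2| < r2 ->
    dens R s t < (1 + f) * dens R z.1 z.2.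
  have lt1 : dens R s t / (1 + f) < dens R s t.
    by rewrite ltr_pdivrMr // ltr_pMr // ltrDl.
  have : nbhs (s, t) [set z : R * R | dens R s t / (1 + f) < dens R z.1 z.2].
    exact: (cvgr_gt _ (dens_continuous R (s, t)) _ lt1).
  move=> /nbhs_ballP[r2 /= r20 hr2].
  exists r2 => // z h1 h2; have := hr2 z (conj h1 h2).
  by rewrite /= ltr_pdivrMr // (mulrC (1 + f)).
exists (Num.min r1 (r2 / (w + h))); first by rewrite lt_min r10 divr_gt0.
move=> r /andP[rp]; rewrite lt_min ltr_pdivlMr // => /andP[k2 k3] X Y Xs Yt.
have wr0 : 0 < w * r by rewrite mulr_gt0.
have hr0 : 0 < h * r by rewrite mulr_gt0.
have etar : 0 < eta * r by rewrite mulr_gt0.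
have le1 : mass X (X + w * r) Y (Y + h * r) <=
    (w + 2 * eta) * (h + 2 * eta) * r ^+ 2 * (dens R s t / K).
  have sub := hr1 r ltac:(by rewrite rp) X Y Xs Yt.
  set l1 := X - s - _ + _ in sub; set l2 := X + w * r - s + _ + _ in sub.
  set m1 := Y - t - _ + _ in sub; set m2 := Y + h * r - t + _ + _ in sub.
  have el : l2 - l1 = (w + 2 * eta) * r by rewrite /l1 /l2; ring.
  have em : m2 - m1 = (h + 2 * eta) * r by rewrite /m1 /m2; ring.
  have w2 : 0 < w + 2 * eta by rewrite addr_gt0 // mulr_gt0.
  have h2 : 0 < h + 2 * eta by rewrite addr_gt0 // mulr_gt0.
  have l12 : l1 <= l2 by rewrite -subr_ge0 el ltW // mulr_gt0.
  have m12 : m1 <= m2 by rewrite -subr_ge0 em ltW // mulr_gt0.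
  rewrite -lee_fin /mass fineK ?box_fin //.
  have -> : (w + 2 * eta) * (h + 2 * eta) * r ^+ 2 * (dens R s t / K) =
     (l2 - l1) * (m2 - m1) / (a * d - b ^+ 2).
    by rewrite Dd el em; field; rewrite !gt_eqF.
  rewrite -lam2_parallelogram //.
  by apply: le_measure => //; rewrite inE; [exact: measurable_box|exact: measurable_parallelogram].
have XX : X < X + w * r by rewrite ltrDl.
have YY : Y < Y + h * r by rewrite ltrDl.
have [xi [ze [xi1 ze1 ->]]] := angle_rectE R _ _ _ _ XX YY.
have le2 : dens R s t <= (1 + f) * dens R xi ze.
  apply/ltW/(hr2 (xi, ze)) => /=; rewrite mulrDr in k3.
    by apply: dist_lt_itv Xs xi1; apply: le_lt_trans k3; rewrite mulrC lerDl mulr_ge0 ?ltW.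
  by apply: dist_lt_itv Yt ze1; apply: le_lt_trans k3; rewrite mulrC lerDr mulr_ge0 ?ltW.
have dxz := dens_gt0 R xi ze.
apply: (@le_trans _ _ ((w + 2 * eta) * (h + 2 * eta) * r ^+ 2 * dens R s t)).
  have -> : (w + 2 * eta) * (h + 2 * eta) * r ^+ 2 * dens R s t =
    K * ((w + 2 * eta) * (h + 2 * eta) * r ^+ 2 * (dens R s t / K)).
    by field; rewrite gt_eqF.
  by rewrite ler_pM2l.
have -> : X + w * r - X = w * r by ring.
have -> : Y + h * r - Y = h * r by ring.
have w2 : 0 < w + 2 * eta by rewrite addr_gt0 // mulr_gt0.
have h2 : 0 < h + 2 * eta by rewrite addr_gt0 // mulr_gt0.
have le3 : (w + 2 * eta) * (h + 2 * eta) <= (1 + f) * (w * h).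
  apply: (@le_trans _ _ ((w * (1 + f / 3)) * (h * (1 + f / 3)))).
    apply: ler_pM; rewrite ?(ltW w2) ?(ltW h2) //.
      exact: pad_le.
    exact: pad_le.
  have -> : w * (1 + f / 3) * (h * (1 + f / 3)) = (1 + f / 3) ^+ 2 * (w * h) by ring.
  by rewrite ler_pM2r ?mulr_gt0.
have r2p : 0 < r ^+ 2 by rewrite exprn_gt0.
apply: (@le_trans _ _ ((1 + f) * (w * h) * r ^+ 2 * ((1 + f) * dens R xi ze))).
  apply: ler_pM => //; [|exact: ltW|by rewrite ler_pM2r].
  by apply/ltW; rewrite !mulr_gt0.
have -> : (1 + f) * (w * h) * r ^+ 2 * ((1 + f) * dens R xi ze) =
  (1 + f) ^+ 2 * (w * r * (h * r) * dens R xi ze) by ring.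
by rewrite ler_pM2r ?mulr_gt0.
Qed.

(** Bisection applied to $(1+e)$ times the solid angle minus $K$ times the mass; then $e$ tends to
    $0$. The slack $e$ absorbs the local errors. *)
Lemma mass_le a b c d : a < b -> c < d -> K * mass a b c d <= angle_rect R a b c d.
Proof.
move=> ab cd.
have [w0 h0] : 0 < b - a /\ 0 < d - c by rewrite !subr_gt0.
have A0 := angle_rect_gt0 R _ _ _ _ ab cd.
have key e : 0 < e <= 1 -> K * mass a b c d <= (1 + e) * angle_rect R a b c d.
  move=> e01; rewrite -subr_ge0.
  have := @bisection_ge0 R (fun a b c d => (1 + e) * angle_rect R a b c d - K * mass a b c d)
    (b - a) (d - c) w0 h0 _ _ _ a c.
  rewrite !subrKC; apply => [a' b' f c' d' ? ?|a' b' c' f d' ? ?|s t].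
  - by rewrite -(mass_addx a' b' f c' d') // -(angle_rect_addx R a' b' f c' d'); ring.
  - by rewrite -(mass_addy a' b' c' f d') // -(angle_rect_addy R a' b' c' f d'); ring.
  - have [r0 r00 hr] := mass_local e _ _ s t e01 w0 h0.
    by exists r0 => // r rr X Y h1 h2; rewrite subr_ge0; apply: hr.
apply/ler_addgt0Pr => e e0.
pose e' := Num.min 1 (e / angle_rect R a b c d).
have h1 : 0 < e' <= 1 by rewrite lt_min ltr01 divr_gt0 //= ge_min lexx.
have : e' * angle_rect R a b c d <= e.
  by rewrite -ler_pdivlMr // ge_min lexx orbT.
have := key e' h1; lra.
Qed.

End CurvatureMass.

(** * Equality of masses and transport of measure *)

Lemma rect_monotone (R : realType) (D : R -> R -> R -> R -> R) (a b c d n : R) :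
  (forall i j k l, i < j -> k < l -> 0 <= D i j k l) ->
  (forall i j m k l, i < j -> j < m -> D i j k l + D j m k l = D i m k l) ->
  (forall i j k m l, k < m -> m < l -> D i j k m + D i j m l = D i j k l) ->
  a < b -> c < d -> - n < a -> b < n -> - n < c -> d < n ->
  D a b c d <= D (- n) n (- n) n.
Proof.
move=> D0 Dx Dy ab cd na bn nc dn.
have nn : - n < n by exact: lt_trans na (lt_trans ab bn).
apply: (@le_trans _ _ (D (- n) n c d)).
  rewrite -(Dx (- n) a n) ?(lt_trans ab) // -(Dx a b n) //.
  by rewrite addrCA lerDl addr_ge0 // D0.
rewrite -(Dy _ _ (- n) c n) ?(lt_trans cd) // -(Dy _ _ c d n) //.
by rewrite addrCA lerDl addr_ge0 // D0.
Qed.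

Lemma le_sum4 (R : realType) (a b c d : R) : 0 <= a -> 0 <= b -> 0 <= c -> 0 <= d ->
  [/\ a <= a + b + c + d, b <= a + b + c + d, c <= a + b + c + d & d <= a + b + c + d].
Proof. by split; lra. Qed.

Lemma itv_natr (R : realType) (y : R) (n : nat) : `|y| < n%:R -> - n%:R < y < n%:R.
Proof. by rewrite ltr_norml. Qed.

Section Transport.
Variable R : realType.
Local Notation plane := (measurableTypeR R * measurableTypeR R)%type.
Variables (O : set (R * R)) (K : R).
Hypotheses (oO : open O) (K0 : 0 < K)
  (cO : forall x y t, O x -> O y -> 0 <= t <= 1 -> O (t *: x + (1 - t) *: y))
  (finO : (lam2 O < +oo)%E) (totO : K * fine (lam2 O) = 2 * pi).

Let mO : measurable (O : set plane).
Proof. exact: open_measurable_plane. Qed.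

(** The defect [D] is nonnegative and additive, hence monotone in the rectangle. On large squares it
    is at most $2\pi$ minus $K$ times a mass that tends to $\mathcal{A}(\Omega)$, so it vanishes on
    every rectangle. *)
Lemma mass_eq p q a b c d : curvature_map R O K p q -> a < b -> c < d ->
  K * mass R O p q a b c d = angle_rect R a b c d.
Proof.
move=> cm ab cd.
pose D a b c d := angle_rect R a b c d - K * mass R O p q a b c d.
have D0 i j k l : i < j -> k < l -> 0 <= D i j k l.
  by move=> ? ?; rewrite subr_ge0; exact: (mass_le R O K p q oO K0 cO finO cm).
have Dx i j m k l : i < j -> j < m -> D i j k l + D j m k l = D i m k l.
  move=> h1 h2; rewrite /D -(angle_rect_addx R i j m).
  rewrite -(mass_addx R O K p q oO finO cm i j m) ?ltW //; ring.
have Dy i j k m l : k < m -> m < l -> D i j k m + D i j m l = D i j k l.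
  move=> h1 h2; rewrite /D -(angle_rect_addy R i j k m l).
  rewrite -(mass_addy R O K p q oO finO cm i j k m l) ?ltW //; ring.
apply/eqP; rewrite eq_le (mass_le R O K p q oO K0 cO finO cm) //= -subr_le0.
apply/ler_addgt0Pr => e e0; rewrite add0r.
pose B (n : nat) := box R O p q (- n%:R) n%:R (- n%:R) n%:R.
have mB n : measurable (B n) := measurable_box R O K p q oO cm _ _ _ _.
have UB : \bigcup_n B n = O.
  apply/seteqP; split => [z [n _ []]//|z Oz].
  pose M := `|p z| + `|q z| + 1.
  have M0 : 0 <= M by rewrite !addr_ge0.
  exists (Num.truncn M).+1 => //; rewrite /B /box /=.
  have := truncnS_gt M; set n := (_.+1)%:R => Mn.
  have : - `|p z| <= p z <= `|p z| by rewrite -ler_norml.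
  have : - `|q z| <= q z <= `|q z| by rewrite -ler_norml.
  have := normr_ge0 (p z); have := normr_ge0 (q z).
  by rewrite /M in Mn; split => //; split; lra.
have cvgB : (lam2 \o B) n @[n --> \oo] --> lam2 O.
  rewrite -UB; apply: nondecreasing_cvg_mu => //; first by rewrite UB.
  move=> n m nm; apply/subsetPset => z [Oz [h1 h2]]; split => //=.
  have : n%:R <= m%:R :> R by rewrite ler_nat.
  by split; lra.
have finOn : lam2 O \is a fin_num by rewrite ge0_fin_numE.
have cvgF : (fine \o (lam2 \o B)) n @[n --> \oo] --> fine (lam2 O).
  by apply: fine_cvg; rewrite fineK.
have eK : 0 < e / K by rewrite divr_gt0.
have /cvgrPdist_lt /(_ _ eK)[N _ hN] := cvgF.
pose M := `|a| + `|b| + `|c| + `|d|.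
pose n := maxn N (Num.truncn M).+1.
have Mn : M < n%:R.
  by apply: lt_le_trans (truncnS_gt M) _; rewrite ler_nat leq_maxr.
have hn : `|fine (lam2 O) - mass R O p q (- n%:R) n%:R (- n%:R) n%:R| < e / K.
  exact: (hN n (leq_maxl _ _)).
have ltn (y : R) : `|y| <= M -> - n%:R < y < n%:R.
  by move=> yM; apply: itv_natr; apply: le_lt_trans Mn.
have [] : [/\ `|a| <= M, `|b| <= M, `|c| <= M & `|d| <= M].
  exact: le_sum4.
move=> /ltn/andP[a1 a2] /ltn/andP[b1 b2] /ltn/andP[c1 c2] /ltn/andP[d1 d2].
apply: (le_trans (rect_monotone _ D a b c d n%:R D0 Dx Dy ab cd a1 b2 c1 d2)).
rewrite /D; apply: (@le_trans _ _ (2 * pi - K * mass R O p q (- n%:R) n%:R (- n%:R) n%:R)).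
  by rewrite lerD2r; exact: angle_rect_le2pi.
rewrite -totO -mulrBr mulrC -ler_pdivlMr //.
exact: le_trans (ler_norm _) (ltW hn).
Qed.

Let G : set (set plane) := [set A `*` B | A in @ocitv R & B in @ocitv R].

(** A cylinder over a half-open interval is a countable union of half-open rectangles, so these
    generate the product $\sigma$-algebra. They are stable under intersection, as uniqueness of
    measures requires. *)
Let measurable_G : (measurable : set (set plane)) = <<s G >>.
Proof.
rewrite measurable_prod_measurableType; apply/seteqP; split; last first.
  apply: smallest_sub; first exact: smallest_sigma_algebra.
  move=> _ [A oA [B oB] <-]; apply: sub_sigma_algebra.
  by exists A; [exact: sub_sigma_algebra|exists B => //; exact: sub_sigma_algebra].
have oc n : @ocitv R `]- n%:R, n%:R]%classic by exists (- n%:R, n%:R).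
have cov (y : R) : exists n : nat, - n%:R < y <= n%:R.
  exists (Num.truncn `|y|).+1; have := truncnS_gt `|y|.
  have : - `|y| <= y <= `|y| by rewrite -ler_norml.
  have := normr_ge0 y; lra.
have m1 : measurable_fun setT (fst : g_sigma_algebraType G -> measurableTypeR R).
  apply: (@measurability _ _ _ _ setT _ (@ocitv R)) => // _ [A oA <-].
  rewrite setTI.
  have -> : fst @^-1` A = \bigcup_n (A `*` `]- n%:R, n%:R]%classic) :> set (R * R).
    apply/seteqP; split => [z Az|z [n _ []]//].
    by have [n hn] := cov z.2; exists n => //; split => //=; rewrite in_itv.
  by apply: bigcupT_measurable => n; apply: sub_sigma_algebra; exists A => //; exists `]- n%:R, n%:R]%classic.
have m2 : measurable_fun setT (snd : g_sigma_algebraType G -> measurableTypeR R).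
  apply: (@measurability _ _ _ _ setT _ (@ocitv R)) => // _ [A oA <-].
  rewrite setTI.
  have -> : snd @^-1` A = \bigcup_n (`]- n%:R, n%:R]%classic `*` A) :> set (R * R).
    apply/seteqP; split => [z Az|z [n _ []]//].
    by have [n hn] := cov z.1; exists n => //; split => //=; rewrite in_itv.
  by apply: bigcupT_measurable => n; apply: sub_sigma_algebra; exists `]- n%:R, n%:R]%classic => //; exists A.
apply: smallest_sub; first exact: smallest_sigma_algebra.
move=> _ [A mA [B mB] <-].
have := measurableI _ _ (m1 measurableT A mA) (m2 measurableT B mB).
by rewrite !setTI.
Qed.

(** Both push-forwards of the area of [O] are finite and give a rectangle its solid angle over $K$,
    so they agree on all measurable sets. *)
Lemma transport_eq p q p' q' (V : set plane) :
  curvature_map R O K p q -> curvature_map R O K p' q' -> measurable V ->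
  lam2 (O `&` [set z | V (p z, q z)]) = lam2 (O `&` [set z | V (p' z, q' z)]).
Proof.
move=> cm cm' mV.
pose f (p q : R * R -> R) (z : plane) : plane := ((p \_ O) z, (q \_ O) z).
have mf p1 q1 : curvature_map R O K p1 q1 -> measurable_fun setT (f p1 q1).
  move=> h; apply/measurable_fun_pair; apply/(measurable_restrictT _ mO);
  apply: measurable_fun_open => // x Ox;
  by have [] := curvature_map_continuous R O K p1 q1 oO h x Ox.
have fE p1 q1 (W : set plane) : mrestr lam2 mO (f p1 q1 @^-1` W) =
    lam2 (O `&` [set z | W (p1 z, q1 z)]).
  rewrite /mrestr setIC; congr (lam2 _).
  by apply/seteqP; split => z [Oz]; rewrite /f /= /patch mem_set.
rewrite -!fE.
pose g n : set plane := `]- n%:R, n%:R]%classic `*` `]- n%:R, n%:R]%classic.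
have oc a b : @ocitv R `]a, b]%classic by exists (a, b).
have cov (y : R) : exists n : nat, forall m, (n <= m)%N -> - m%:R < y <= m%:R.
  exists (Num.truncn `|y|).+1 => m nm; have := truncnS_gt `|y|.
  have : (Num.truncn `|y|).+1%:R <= m%:R :> R by rewrite ler_nat.
  have : - `|y| <= y <= `|y| by rewrite -ler_norml.
  have := normr_ge0 y; lra.
have mass_rect p1 q1 (cm1 : curvature_map R O K p1 q1) a b c d :
    lam2 (O `&` [set z | (`]a, b]%classic `*` `]c, d]%classic) (p1 z, q1 z)]) =
    if (a < b) && (c < d) then (angle_rect R a b c d / K)%:E else 0%E.
  have -> : O `&` [set z | (`]a, b]%classic `*` `]c, d]%classic) (p1 z, q1 z)] =
      box R O p1 q1 a b c d.
    by apply/seteqP; split => z; rewrite /box /= !in_itv.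
  case: ifPn => [/andP[ab cd]|abcd].
    rewrite -(fineK (box_fin R O K p1 q1 oO finO cm1 a b c d)) -/(mass _ _ _ _ _ _ _ _).
    by rewrite -(mass_eq p1 q1) // mulrC mulKf // gt_eqF.
  rewrite (_ : box _ _ _ _ _ _ _ _ = set0) ?measure0 //.
  apply/seteqP; split => z //; rewrite /box /= => -[_ [h1 h2]].
  by move: abcd; rewrite negb_and -!leNgt => /orP[]; lra.
pose m1 : {measure set plane -> \bar R} := mrestr lam2 mO.
have fE1 p1 q1 (W : set plane) : pushforward m1 (f p1 q1) W =
    lam2 (O `&` [set z | W (p1 z, q1 z)]) by exact: fE.
have e1 (A : set plane) : G A -> pushforward m1 (f p q) A = pushforward m1 (f p' q') A.
  by move=> [_ [[a b] _ <-] [_ [[c d] _ <-] <-]]; rewrite !fE1 !mass_rect.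
have e2 k : (pushforward m1 (f p q) (g k) < +oo)%E.
  rewrite fE1; apply: le_lt_trans finO; apply: le_measure => //.
  - by rewrite inE; apply: measurable_preimage_map cm _ _ => //; apply: measurableX; exact: measurable_itv.
  - by rewrite inE.
have Gg i : G (g i) by exists `]- i%:R, i%:R]%classic => //; exists `]- i%:R, i%:R]%classic.
have cg : \bigcup_k g k = setT.
  apply/seteqP; split => // z _.
  have [n1 h1] := cov z.1; have [n2 h2] := cov z.2.
  exists (maxn n1 n2) => //; split; rewrite /= in_itv /=; [exact: (h1 _ (leq_maxl _ _))|exact: (h2 _ (leq_maxr _ _))].
have GI : setI_closed G.
  move=> _ _ [A oA [B oB <-]] [A' oA' [B' oB' <-]].
  by exists (A `&` A'); [exact: ocitvI|exists (B `&` B'); [exact: ocitvI|rewrite setXI]].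
have mf1 := mf _ _ cm; have mf2 := mf _ _ cm'.
have -> : mrestr lam2 mO (f p q @^-1` V) = pushforward m1 (f p q) V by [].
have -> : mrestr lam2 mO (f p' q' @^-1` V) = pushforward m1 (f p' q') V by [].
apply: (@measure_unique _ R plane G g measurable_G GI Gg cg _ _ _ _ V mV) => //.
Qed.

End Transport.

(** * Uniqueness of the gradient *)

Section Uniqueness.
Variable R : realType.
Local Notation plane := (measurableTypeR R * measurableTypeR R)%type.

Lemma lam2_open_gt0 (B : set (R * R)) z : open B -> B z -> (0 < lam2 B)%E.
Proof.
move=> oB Bz.
have /nbhs_ballP[r /= r0 rB] := open_nbhs_nbhs (conj oB Bz).
have r20 : 0 < r / 2 by rewrite divr_gt0.
have le1 (x : R) : x - r / 2 <= x + r / 2 by lra.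
apply: (@lt_le_trans _ _ (lam2 (`[z.1 - r / 2, z.1 + r / 2]%classic `*`
    `[z.2 - r / 2, z.2 + r / 2]%classic))).
  rewrite lam2_rectangle // lte_fin.
  have -> : z.1 + r / 2 - (z.1 - r / 2) = r by field.
  have -> : z.2 + r / 2 - (z.2 - r / 2) = r by field.
  by rewrite mulr_gt0.
apply: le_measure; rewrite ?inE.
- by apply: measurableX; exact: measurable_itv.
- exact: open_measurable_plane.
- have ball_itv (x y : R) : y \in `[x - r / 2, x + r / 2] -> `|x - y| < r.
    by rewrite in_itv /= ltr_norml; lra.
  by move=> y [/= h1 h2]; apply: rB; split; apply: ball_itv.
Qed.

Lemma nbhs_line (x : R * R) (N : set (R * R)) (e1 e2 : R) : nbhs x N ->
  exists2 t, 0 < t & forall s, `|s| <= t -> N (x.1 + s * e1, x.2 + s * e2).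
Proof.
move=> /nbhs_ballP[r /= r0 rN].
have M0 : 0 < `|e1| + `|e2| + 1 by rewrite ltr_wpDl // addr_ge0.
exists (r / 2 / (`|e1| + `|e2| + 1)); first by rewrite !divr_gt0.
move=> s; rewrite ler_pdivlMr // => sr.
have small e : `|e| <= `|e1| + `|e2| + 1 -> `|s * e| < r.
  move=> eM; rewrite normrM.
  have : `|s| * `|e| <= `|s| * (`|e1| + `|e2| + 1) by rewrite ler_wpM2l.
  lra.
have n1 := normr_ge0 e1; have n2 := normr_ge0 e2.
by apply: rN; split; rewrite /ball /= opprD addrA subrr add0r normrN; apply: small; lra.
Qed.

(** The form in which convexity is used from here on: a supporting plane at each point, with
    prescribed slopes. *)
Definition subgradient (O : set (R * R)) (u p q : R * R -> R) := forall x y, O x -> O y ->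
  u x + (p x * (y.1 - x.1) + q x * (y.2 - x.2)) <= u y.

Variables (O : set (R * R)) (K : R).
Hypotheses (oO : open O) (K0 : 0 < K)
  (cO : forall x y t, O x -> O y -> 0 <= t <= 1 -> O (t *: x + (1 - t) *: y))
  (finO : (lam2 O < +oo)%E) (totO : K * fine (lam2 O) = 2 * pi).
Variables u p q v p' q' : R * R -> R.
Hypotheses (cm : curvature_map R O K p q) (cm' : curvature_map R O K p' q').
Hypotheses (su : subgradient O u p q) (sv : subgradient O v p' q').
Hypotheses (cu : forall x, O x -> {for x, continuous u})
           (cv : forall x, O x -> {for x, continuous v}).

(** Coercivity makes the image of an open set open relative to the range, and the range is closed.
    The image is thus a closed set intersected with an open one. *)
Lemma measurable_image_open (U : set (R * R)) : open U -> U `<=` O ->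
  measurable ([set z | exists2 x, U x & p x = z.1 /\ q x = z.2] : set plane).
Proof.
move=> oU UO.
pose V : set (R * R) := [set z | exists2 x, U x & p x = z.1 /\ q x = z.2].
pose rg : set (R * R) := [set z | exists2 x, O x & p x = z.1 /\ q x = z.2].
have orgC : open (~` rg).
  rewrite openE => z nz; case: cm => _ _ /(_ z.1 z.2)[//|[e e0 he]].
  rewrite /interior; have := dist1_near R z e e0; apply: filterS => y yz [x Ox [px qx]].
  by have := he x Ox; rewrite px qx leNgt yz.
have -> : [set z | exists2 x, U x & p x = z.1 /\ q x = z.2] = rg `&` (V `|` ~` rg)°.
  apply/seteqP; split; last first.
    by move=> z [rz /interior_subset[]].
  move=> z [x Ux [px qx]]; split; first by exists x => //; exact: UO.
  have Ox := UO _ Ux.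
  have [c [r [c0 r0 hc]]] := curvature_map_coercive R O K p q K0 cO cm x Ox.
  have /nbhs_ballP[s /= s0 sU] := open_nbhs_nbhs (conj oU Ux).
  pose m0 := Num.min r (s / 2).
  have m00 : 0 < m0 by rewrite lt_min r0 divr_gt0.
  rewrite /interior; have := dist1_near R z (c * m0) (mulr_gt0 c0 m00).
  apply: filterS => y yz; have [[y' Oy' [py qy]]|] := pselect (rg y); last by right.
  left; exists y' => //; apply: sU.
  have [h1 h2] := hc y' Oy'.
  have dle := dot_le_norm1 R (p y' - p x) (q y' - q x) (y'.1 - x.1) (y'.2 - x.2).
  rewrite -/(dotdiff R p q x y') -/(dist1 R x y') px qx py qy -/(dist1 R z y) in dle.
  have m_ge0 : 0 <= dist1 R x y' by rewrite addr_ge0.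
  have small : dist1 R x y' < s.
    have [m_le|m_gt] := leP (dist1 R x y') (s / 2); first by lra.
    have mp : 0 < dist1 R x y' by apply: lt_trans m_gt; rewrite divr_gt0.
    exfalso.
    have : c * m0 <= dist1 R z y.
      rewrite -(ler_pM2r mp); apply: le_trans dle.
      have [m_le|m_gt'] := leP (dist1 R x y') r.
        apply: le_trans (h1 m_le); rewrite expr2 mulrA ler_pM2r // ler_pM2l //.
        by rewrite ge_min (ltW m_gt) orbT.
      apply: le_trans (h2 (ltW m_gt')); rewrite ler_pM2r // ler_pM2l //.
      by rewrite ge_min lexx.
    by rewrite leNgt yz.
  split; rewrite /ball /= distrC; apply: le_lt_trans small.
    by rewrite /dist1 lerDl.
  by rewrite /dist1 lerDr.
apply: measurableI; last by apply: open_measurable_plane; exact: open_interior.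
by rewrite -[X in measurable X]setCK; apply: measurableC; exact: open_measurable_plane.
Qed.

(* Aleksandrov's argument: where $u - v$ vanishes but the gradients differ, the set
   $U = \{u > v\}$ has a $(p',q')$-preimage of its $(p,q)$-image that is contained
   in $U$ but misses a nonempty open part of it, although both have the same area. *)
Lemma gradient_unique x0 : O x0 -> p x0 = p' x0 /\ q x0 = q' x0.
Proof.
move=> Ox0.
have [ctp ctq] := curvature_map_continuous R O K p q oO cm x0 Ox0.
have [ctp' ctq'] := curvature_map_continuous R O K p' q' oO cm' x0 Ox0.
pose e1 := p' x0 - p x0; pose e2 := q' x0 - q x0.
have [e0|e0] := leP (e1 ^+ 2 + e2 ^+ 2) 0.
  have /eqP : e1 ^+ 2 + e2 ^+ 2 = 0.
    by apply/eqP; rewrite eq_le e0 addr_ge0 // sqr_ge0.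
  rewrite paddr_eq0 ?sqr_ge0 // !sqrf_eq0 !subr_eq0 => /andP[/eqP -> /eqP ->].
  by [].
exfalso.
pose U := [set x | O x /\ v x - v x0 < u x - u x0].
have UO : U `<=` O by move=> x [].
have oU : open U.
  rewrite openE => x [Ox ux].
  have cw : {for x, continuous (fun x => (u x - u x0) - (v x - v x0))}.
    apply: continuousB; apply: continuousB; try exact: cst_continuous; [exact: cu|exact: cv].
  have w0 : 0 < (u x - u x0) - (v x - v x0) by rewrite subr_gt0.
  have h1 : nbhs x [set y | 0 < (u y - u x0) - (v y - v x0)].
    exact: (cvgr_gt _ cw _ w0).
  have h2 := open_nbhs_nbhs (conj oO Ox).
  rewrite /interior; apply: filterS (filterI h2 h1) => y [Oy /=].
  by rewrite subr_gt0.
pose V : set plane := [set z | exists2 x, U x & p x = z.1 /\ q x = z.2].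
have mV : measurable V by exact: measurable_image_open.
have key := transport_eq R O K oO K0 cO finO totO p q p' q' V cm cm' mV.
have pp' : p x0 * e1 + q x0 * e2 < p' x0 * e1 + q' x0 * e2.
  rewrite -subr_gt0; suff -> : p' x0 * e1 + q' x0 * e2 - (p x0 * e1 + q x0 * e2) =
    e1 ^+ 2 + e2 ^+ 2 by [].
  by rewrite /e1 /e2; ring.
have h1 : nbhs x0 [set y | p y * e1 + q y * e2 < p' x0 * e1 + q' x0 * e2].
  have c1 : {for x0, continuous (fun y => p y * e1 + q y * e2)}.
    by apply: continuousD; apply: continuousM => //; exact: cst_continuous.
  exact: (cvgr_lt _ c1 _ pp').
have h2 : nbhs x0 [set y | p x0 * e1 + q x0 * e2 < p' y * e1 + q' y * e2].
  have c1 : {for x0, continuous (fun y => p' y * e1 + q' y * e2)}.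
    by apply: continuousD; apply: continuousM => //; exact: cst_continuous.
  exact: (cvgr_gt _ c1 _ pp').
have hO := open_nbhs_nbhs (conj oO Ox0).
have [t t0 ht] := nbhs_line x0 _ e1 e2 (filterI hO h1).
(* Moving from [x0] along the difference of gradients, the plane supporting [v] at [x0] rises
   strictly above [u] at [y], both normalised at [x0]. Nearby base points [b] keep this property and
   form the open set [B]. *)
pose y : R * R := (x0.1 + t * e1, x0.2 + t * e2).
have [Oy ylt] : O y /\ p y * e1 + q y * e2 < p' x0 * e1 + q' x0 * e2.
  by apply: (ht t); rewrite (ger0_norm (ltW t0)).
have uy : u y - u x0 < p' x0 * (y.1 - x0.1) + q' x0 * (y.2 - x0.2).
  have := su y x0 Oy Ox0; rewrite /y /=.
  have -> : p (x0.1 + t * e1, x0.2 + t * e2) * (x0.1 - (x0.1 + t * e1)) +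
    q (x0.1 + t * e1, x0.2 + t * e2) * (x0.2 - (x0.2 + t * e2)) =
    - (t * (p y * e1 + q y * e2)) by rewrite /y; ring.
  have -> : p' x0 * (x0.1 + t * e1 - x0.1) + q' x0 * (x0.2 + t * e2 - x0.2) =
    t * (p' x0 * e1 + q' x0 * e2) by ring.
  have : t * (p y * e1 + q y * e2) < t * (p' x0 * e1 + q' x0 * e2) by rewrite ltr_pM2l.
  lra.
have hB : nbhs x0 [set b | u y - u x0 <
    (v b - v x0) + (p' b * (y.1 - b.1) + q' b * (y.2 - b.2))].
  have c1 : {for x0, continuous (fun b =>
      (v b - v x0) + (p' b * (y.1 - b.1) + q' b * (y.2 - b.2)))}.
    apply: continuousD; first by apply: continuousB; [exact: cv|exact: cst_continuous].
    apply: continuousD; apply: continuousM => //; apply: continuousB;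
      first [exact: cst_continuous | exact: cvg_fst | exact: cvg_snd].
  by apply: (cvgr_gt _ c1 _ _); rewrite subrr add0r.
pose B : set (R * R) := [set b | u y - u x0 <
    (v b - v x0) + (p' b * (y.1 - b.1) + q' b * (y.2 - b.2))]°.
have oB : open B by exact: open_interior.
have [s s0 hs] := nbhs_line x0 _ e1 e2 (filterI (filterI hO h2)
   (open_nbhs_nbhs (conj oB (hB : B x0)))).
(* In the opposite direction $u - v$ is positive, and for small [s] the point is still in [B]; so $U
   \cap B$ is open and nonempty. *)
pose z : R * R := (x0.1 + - s * e1, x0.2 + - s * e2).
have [[Oz zlt] Bz] : (O z /\ p x0 * e1 + q x0 * e2 < p' z * e1 + q' z * e2) /\ B z.
  by apply: (hs (- s)); rewrite normrN (ger0_norm (ltW s0)).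
have Uz : U z.
  split => //.
  have := su x0 z Ox0 Oz; have := sv z x0 Oz Ox0; rewrite /z /=.
  set vz := v _; set uz := u _; set pz := p' _; set qz := q' _.
  have -> : pz * (x0.1 - (x0.1 + - s * e1)) + qz * (x0.2 - (x0.2 + - s * e2)) =
    s * (p' z * e1 + q' z * e2) by rewrite /pz /qz /z; ring.
  have -> : p x0 * (x0.1 + - s * e1 - x0.1) + q x0 * (x0.2 + - s * e2 - x0.2) =
    - (s * (p x0 * e1 + q x0 * e2)) by ring.
  have : s * (p x0 * e1 + q x0 * e2) < s * (p' z * e1 + q' z * e2) by rewrite ltr_pM2l.
  lra.
have mU : measurable (U : set plane) by exact: open_measurable_plane.
have mB : measurable (B : set plane) by exact: open_measurable_plane.
have mX := measurable_preimage_map R O K p' q' oO cm' V mV.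
have sub1 : U `<=` O `&` [set z | V (p z, q z)].
  by move=> x Ux; split; [exact: UO|exists x].
(* If the slopes of [v] at [b] are those of [u] at some [a] in [U], the plane supporting [v] at [b]
   passes strictly below [u] at [a], hence everywhere. Tested at [b] this gives membership in [U],
   tested at [y] it excludes [B]. *)
have sub2 : O `&` [set z | V (p' z, q' z)] `<=` U `\` B.
  move=> b [Ob [a Ua /= [pa qa]]]; have Oa := UO _ Ua.
  have le_u (w : R * R) : O w -> (v b - v x0) + (p' b * (w.1 - b.1) + q' b * (w.2 - b.2)) <
      u w - u x0.
    move=> Ow; have h3 := su a w Oa Ow; have h4 := sv b a Ob Oa; have [_ h5] := Ua.
    rewrite pa qa in h3; lra.
  split; last first.
    by move=> /interior_subset /= h6; have := lt_trans h6 (le_u y Oy); rewrite ltxx.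
  split => //; have := le_u b Ob; lra.
have posUB : (0 < lam2 (U `&` B))%E by apply: (lam2_open_gt0 _ z) => //; exact: openI.
have finU : lam2 U \is a fin_num by exact: (lam2_fin R O oO finO).
have : (lam2 U <= lam2 (U `\` B))%E.
  apply: (@le_trans _ _ (lam2 (O `&` [set z | V (p z, q z)]))).
    by apply: le_measure; rewrite ?inE //; exact: (measurable_preimage_map R O K p q oO cm V mV).
  rewrite key; apply: le_measure; rewrite ?inE //; exact: measurableD.
rewrite leNgt => /negP; apply.
have -> : lam2 (U `\` B) = (lam2 U - lam2 (U `&` B))%E by apply: measureD => //; rewrite ltey_eq finU.
by rewrite lteBlDr ?lteDl // (lam2_fin R O oO finO) //; [exact: measurableI|move=> ? [/UO]].
Qed.

End Uniqueness.

(** * Second derivatives *)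

Section Differentiation.
Variable R : realType.
Notation e1 := (e1 R).
Notation e2 := (e2 R).
Implicit Types f u : R * R -> R.

Lemma derive_plane f (x v : R * R) : differentiable f x ->
  'D_v f x = v.1 * 'D_e1 f x + v.2 * 'D_e2 f x.
Proof.
move=> df; rewrite !deriveE //.
have {1}-> : v = v.1 *: e1 + v.2 *: e2.
  case: v => a b /=; apply/pair_equal_spec; split; rewrite /= /GRing.scale /=; ring.
by rewrite linearD !linearZ.
Qed.

Lemma differentiable_expansion f x e : differentiable f x -> 0 < e ->
  exists2 r, 0 < r & forall y, dist1 R x y < r ->
    `|f y - f x - ('D_e1 f x * (y.1 - x.1) + 'D_e2 f x * (y.2 - x.2))| <= e * dist1 R x y.
Proof.
move=> df e0.
have /eqaddoP /(_ _ e0) := diff_locally df.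
move=> /nbhs_ballP[r /= r0 hr].
exists r => // y yr.
have n1 := normr_ge0 (y.1 - x.1); have n2 := normr_ge0 (y.2 - x.2).
have yx : ball (0 : R * R) r (y - x).
  by move: yr; rewrite /dist1 => yr; split; rewrite /ball /= sub0r normrN; lra.
have := hr _ yx; rewrite /= !fctE /= subrK opprD addrA -deriveE // derive_plane //=.
rewrite !(mulrC (_ - _)) => h; apply: le_trans h _.
rewrite ler_pM2l // prod_normE /= ge_max /dist1 lerDl lerDr.
by rewrite !normr_ge0.
Qed.

Lemma is_derive_fst f (s c : R) : differentiable f (s, c) ->
  is_derive s 1 (fun s => f (s, c)) ('D_e1 f (s, c)).
Proof.
move=> /(@diff_derivable _ _ _ _ _ e1).
rewrite /derivable /derive.
set g := (fun h => h^-1 *: _).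
have E : g = (fun h => h^-1 *: (f (h *: 1 + s, c) - f (s, c))).
  apply/funext => h; rewrite /g; congr (_ *: (f _ - _)).
  by apply/pair_equal_spec; split; rewrite /= /GRing.scale /=; ring.
by move=> dg; apply: DeriveDef; rewrite ?/derivable ?/derive -E.
Qed.

Lemma is_derive_snd f (s c : R) : differentiable f (s, c) ->
  is_derive c 1 (fun c => f (s, c)) ('D_e2 f (s, c)).
Proof.
move=> /(@diff_derivable _ _ _ _ _ e2).
rewrite /derivable /derive.
set g := (fun h => h^-1 *: _).
have E : g = (fun h => h^-1 *: (f (s, h *: 1 + c) - f (s, c))).
  apply/funext => h; rewrite /g; congr (_ *: (f _ - _)).
  by apply/pair_equal_spec; split; rewrite /= /GRing.scale /=; ring.
by move=> dg; apply: DeriveDef; rewrite ?/derivable ?/derive -E.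
Qed.

(** Convexity bounds the difference quotients at [x] towards [y], for steps at most 1, by
    [u y - u x]; a larger directional derivative would be violated at some small step. *)
Lemma convex_subgradient O u : convex_fun_on O u ->
  (forall x, O x -> differentiable u x) ->
  subgradient R O u ('D_e1 u) ('D_e2 u).
Proof.
move=> cvx du x y Ox Oy.
have dx := du x Ox.
rewrite -lerBrDl leNgt; apply/negP.
have -> : 'D_e1 u x * (y.1 - x.1) + 'D_e2 u x * (y.2 - x.2) = 'D_(y - x) u x.
  by rewrite (derive_plane _ _ (y - x) dx); congr (_ + _); rewrite mulrC.
move=> lt; have cv := @diff_derivable _ _ _ _ _ (y - x) dx.
have : nbhs (0 : R) [set h | h != 0 -> u y - u x < h^-1 *: (u (h *: (y - x) + x) - u x)].
  exact: (cvgr_gt _ cv _ lt).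
move=> /nbhs_ballP[r /= r0 hr].
pose h := Num.min (r / 2) 1.
have h0 : 0 < h by rewrite lt_min divr_gt0 // ltr01.
have h1 : h <= 1 by rewrite ge_min lexx orbT.
have hb : ball 0 r h.
  rewrite /ball /= sub0r normrN (ger0_norm (ltW h0)).
  by have : h <= r / 2 by [rewrite ge_min lexx]; lra.
have := hr h hb ltac:(by rewrite gt_eqF) => /=.
apply/negP; rewrite -leNgt /GRing.scale /= ler_pdivrMl //.
have := cvx y x Oy Ox h ltac:(by rewrite (ltW h0)).
have -> : h *: y + (1 - h) *: x = h *: (y - x) + x.
  by rewrite scalerBr scalerBl scale1r addrCA addrC -addrA; congr (_ + _); rewrite addrC.
lra.
Qed.

(** The mean value theorem in the first variable reduces the second difference over a square to a
    difference of [P], expanded at the corner. The two errors are at most [e / 3] times $2t$ and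
    $t$, whence the 3. *)
Lemma mixed_increment (w P : R -> R -> R) (x y A B e t : R) : 0 < t -> 0 < e ->
  (forall a b, x <= a <= x + t -> y <= b <= y + t -> is_derive a 1 (w ^~ b) (P a b)) ->
  (forall a b, x <= a <= x + t -> y <= b <= y + t ->
    `|P a b - P x y - (A * (a - x) + B * (b - y))| <= e / 3 * ((a - x) + (b - y))) ->
  `|w (x + t) (y + t) - w (x + t) y - w x (y + t) + w x y - B * t ^+ 2| <= e * t ^+ 2.
Proof.
move=> t0 e0 dw hP.
have y0 : y <= y <= y + t by rewrite lexx lerDl ltW.
have y1 : y <= y + t <= y + t by rewrite lexx lerDl ltW.
pose phi a := w a (y + t) - w a y.
have dphi (a : R) : x <= a <= x + t -> is_derive a 1 phi (P a (y + t) - P a y).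
  by move=> axt; apply: is_deriveB; apply: dw.
have xt : x < x + t by rewrite ltrDl.
have oo a : a \in `]x, x + t[ -> x <= a <= x + t by move=> h; rewrite !(itvP h).
have cc a : a \in `[x, x + t] -> x <= a <= x + t by move=> h; rewrite !(itvP h).
have [a /oo axt fa] := @MVT R phi _ _ _ xt (fun a h => dphi a (oo a h))
  (@derivable_within_continuous R _ phi `[x, x + t] (fun a h =>
     @ex_derive _ _ _ _ _ _ _ (dphi a (cc a h)))).
have := hP a _ axt y0; have := hP a _ axt y1.
have -> : w (x + t) (y + t) - w (x + t) y - w x (y + t) + w x y =
  phi (x + t) - phi x by rewrite /phi; ring.
rewrite fa => E1 E2.
have -> : (P a (y + t) - P a y) * (x + t - x) - B * t ^+ 2 =
  t * ((P a (y + t) - P x y - (A * (a - x) + B * (y + t - y))) -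
       (P a y - P x y - (A * (a - x) + B * (y - y)))) by ring.
rewrite normrM (ger0_norm (ltW t0)) expr2 mulrCA ler_pM2l //.
apply: (le_trans (ler_normB _ _)); apply: (le_trans (lerD E1 E2)).
rewrite -mulrDr mulrAC ler_pdivrMr // -mulrA ler_pM2l //; lra.
Qed.

Lemma close_increments (w a b c s t E : R) : `|w - a - b + c - s| <= E ->
  `|w - b - a + c - t| <= E -> `|s - t| <= 2 * E.
Proof. by rewrite !ler_norml; lra. Qed.

(** The second difference is symmetric in the two axes, so both mixed derivatives approximate the
    same quantity over $t^2$. *)
Lemma mixed_partials_comm u (r : R) x : 0 < r ->
  (forall y, dist1 R x y < r -> differentiable u y) ->
  differentiable ('D_e1 u) x -> differentiable ('D_e2 u) x ->
  'D_e2 ('D_e1 u) x = 'D_e1 ('D_e2 u) x.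
Proof.
case: x => x1 x2 r0 du dp dq; set x := (x1, x2) in du dp dq *.
have dist (a b t : R) : x1 <= a <= x1 + t -> x2 <= b <= x2 + t ->
    dist1 R x (a, b) = (a - x1) + (b - x2) /\ dist1 R x (a, b) <= t * 2.
  move=> h1 h2; rewrite /dist1 /= !ger0_norm; [split => //|..]; lra.
have key e : 0 < e -> `|'D_e2 ('D_e1 u) x - 'D_e1 ('D_e2 u) x| <= 2 * e.
  move=> e0; have e30 : 0 < e / 3 by rewrite divr_gt0.
  have [s s0 hs] := differentiable_expansion _ _ (e / 3) dp e30.
  have [s' s'0 hs'] := differentiable_expansion _ _ (e / 3) dq e30.
  pose t := Num.min r (Num.min s s') / 4.
  have t0 : 0 < t by rewrite divr_gt0 // !lt_min r0 s0.
  have [tr ts ts'] : [/\ t * 2 < r, t * 2 < s & t * 2 < s'].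
    have : Num.min r (Num.min s s') <= r by rewrite ge_min lexx.
    have : Num.min r (Num.min s s') <= s by rewrite !ge_min lexx orbT.
    have : Num.min r (Num.min s s') <= s' by rewrite !ge_min lexx !orbT.
    by rewrite -[Num.min _ _](divfK (_ : 4 != 0)) // -/t; split; lra.
  have t2 : 0 < t ^+ 2 by rewrite exprn_gt0.
  have pd1 (a b : R) : x1 <= a <= x1 + t -> x2 <= b <= x2 + t ->
      is_derive a 1 (fun a => u (a, b)) ('D_e1 u (a, b)).
    move=> h1 h2; apply: is_derive_fst; apply: du.
    by have [_ h] := dist a b t h1 h2; exact: le_lt_trans h tr.
  have qd2 (b a : R) : x2 <= b <= x2 + t -> x1 <= a <= x1 + t ->
      is_derive b 1 (fun b => u (a, b)) ('D_e2 u (a, b)).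
    move=> h2 h1; apply: is_derive_snd; apply: du.
    by have [_ h] := dist a b t h1 h2; exact: le_lt_trans h tr.
  have pe1 (a b : R) : x1 <= a <= x1 + t -> x2 <= b <= x2 + t ->
      `|'D_e1 u (a, b) - 'D_e1 u x -
        ('D_e1 ('D_e1 u) x * (a - x1) + 'D_e2 ('D_e1 u) x * (b - x2))| <=
      e / 3 * ((a - x1) + (b - x2)).
    move=> h1 h2; have [<- h] := dist a b t h1 h2.
    exact: (hs (a, b) (le_lt_trans h ts)).
  have qe2 (b a : R) : x2 <= b <= x2 + t -> x1 <= a <= x1 + t ->
      `|'D_e2 u (a, b) - 'D_e2 u x -
        ('D_e2 ('D_e2 u) x * (b - x2) + 'D_e1 ('D_e2 u) x * (a - x1))| <=
      e / 3 * ((b - x2) + (a - x1)).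
    move=> h2 h1; have [h3 h] := dist a b t h1 h2.
    rewrite [b - _ + _]addrC -h3 [_ * (b - x2) + _]addrC.
    exact: (hs' (a, b) (le_lt_trans h ts')).
  have I1 := @mixed_increment (fun a b => u (a, b)) (fun a b => 'D_e1 u (a, b)) x1 x2
    ('D_e1 ('D_e1 u) x) ('D_e2 ('D_e1 u) x) e t t0 e0.
  have I2 := @mixed_increment (fun b a => u (a, b)) (fun b a => 'D_e2 u (a, b)) x2 x1
    ('D_e2 ('D_e2 u) x) ('D_e1 ('D_e2 u) x) e t t0 e0.
  rewrite -(ler_pM2r t2).
  have -> : `|'D_e2 ('D_e1 u) x - 'D_e1 ('D_e2 u) x| * t ^+ 2 =
    `|'D_e2 ('D_e1 u) x * t ^+ 2 - 'D_e1 ('D_e2 u) x * t ^+ 2|.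
    by rewrite -mulrBl normrM (ger0_norm (ltW t2)).
  have {}I1 := I1 pd1 pe1; have {}I2 := I2 qd2 qe2.
  rewrite -mulrA; exact: (close_increments _ _ _ _ _ _ _ I1 I2).
apply/eqP; rewrite -subr_eq0 -normr_le0; apply/ler_addgt0Pr => e e0.
by have := key (e / 2) ltac:(by rewrite divr_gt0); lra.
Qed.

End Differentiation.

(** * From the curvature equation to a curvature map *)

Lemma subgradient_monotone (R : realType) (O : set (R * R)) (u p q : R * R -> R) x y :
  subgradient R O u p q -> O x -> O y -> 0 <= dotdiff R p q x y.
Proof.
move=> su Ox Oy; have h1 := su x y Ox Oy; have h2 := su y x Oy Ox.
rewrite /dotdiff; lra.
Qed.

Lemma powR_3half (R : realType) (S : R) : 0 < S -> S `^ (3 / 2) = S * Num.sqrt S.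
Proof.
move=> S0; have -> : 3 / 2 = 1 + 2^-1 :> R by field.
rewrite powRD; last by rewrite (gt_eqF S0) implybT.
by rewrite powRr1 ?(ltW S0) // powR12_sqrt ?(ltW S0).
Qed.

Lemma det_of_curvature (R : realType) (a b d s t K : R) :
  (a * d - b ^+ 2) / (1 + s ^+ 2 + t ^+ 2) `^ (3 / 2) = K ->
  a * d - b ^+ 2 = K / dens R s t.
Proof.
have S0 := sqS_gt0 R s t; rewrite powR_3half // => <-.
by rewrite /dens invrK divfK // mulf_neq0 ?gt_eqF ?sqrtr_gt0.
Qed.

(** Monotonicity along the first axis gives $a \ge 0$, and $a = 0$ would leave the determinant $-b^2
    \le 0$. *)
Lemma expansion_of_derivatives (R : realType) (O : set (R * R)) (K : R)
    (p q : R * R -> R) (x : R * R) (a b d r : R) : 0 < K -> 0 < r ->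
  (forall y, dist1 R x y < r -> O y) ->
  a * d - b ^+ 2 = K / dens R (p x) (q x) ->
  (forall y, O y -> 0 <= dotdiff R p q x y) ->
  (forall e, 0 < e -> exists2 s, 0 < s & forall y, dist1 R x y < s ->
    `|p y - p x - (a * (y.1 - x.1) + b * (y.2 - x.2))| <= e * dist1 R x y) ->
  (forall e, 0 < e -> exists2 s, 0 < s & forall y, dist1 R x y < s ->
    `|q y - q x - (b * (y.1 - x.1) + d * (y.2 - x.2))| <= e * dist1 R x y) ->
  expansion_at R O K p q x.
Proof.
move=> K0 r0 rO detE mono hp hq.
have det0 : 0 < a * d - b ^+ 2 by rewrite detE divr_gt0 // dens_gt0.
have a_ge0 : 0 <= a.
  apply/ler_addgt0Pr => e e0; have [s s0 hs] := hp e e0.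
  pose t := Num.min r s / 2.
  have t0 : 0 < t by rewrite divr_gt0 // lt_min r0.
  have [tr ts] : t < r /\ t < s.
    have h1 : Num.min r s <= r by rewrite ge_min lexx.
    have h2 : Num.min r s <= s by rewrite ge_min lexx orbT.
    have h3 : 0 < Num.min r s by rewrite lt_min r0.
    by rewrite /t; split; lra.
  pose y : R * R := (x.1 + t, x.2).
  have y1 : y.1 - x.1 = t by rewrite /y /= addrC addKr.
  have y2 : y.2 - x.2 = 0 by rewrite /y /= subrr.
  have yx : dist1 R x y = t by rewrite /dist1 y1 y2 normr0 addr0 (ger0_norm (ltW t0)).
  have Oy : O y by apply: rO; rewrite yx.
  have := mono y Oy; rewrite /dotdiff y1 y2 mulr0 addr0 pmulr_lge0 // => h1.
  have := hs y; rewrite yx y1 y2 mulr0 addr0 => /(_ ts).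
  rewrite ler_norml => /andP[_ h2].
  have : 0 <= (a + e) * t by rewrite mulrDl; lra.
  by rewrite pmulr_lge0.
have a0 : 0 < a.
  rewrite lt_neqAle a_ge0 andbT; apply/negP => /eqP az.
  by move: det0; rewrite -az mul0r sub0r oppr_gt0 ltNge sqr_ge0.
exists a, b, d; split => // e e0.
have [s1 s10 hs1] := hp e e0; have [s2 s20 hs2] := hq e e0.
exists (Num.min s1 s2); first by rewrite lt_min s10.
by move=> y Oy; rewrite lt_min => /andP[y1 y2]; split; [exact: hs1|exact: hs2].
Qed.

Section GradientMap.
Variable R : realType.
Local Notation plane := (measurableTypeR R * measurableTypeR R)%type.
Notation e1 := (e1 R).
Notation e2 := (e2 R).
Variables (O : set (R * R)) (u : R * R -> R) (K L : R).
Hypotheses (oO : open O) (K0 : 0 < K)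
  (bO : forall x y, O (x, y) -> `|x| <= L /\ `|y| <= L)
  (cvx : convex_fun_on O u) (C2 : C2_on O u)
  (gc : forall x, O x -> gauss_curv u x = K)
  (bd : forall q, closure O q -> ~ O q ->
     gradnorm u x @[x --> within O (nbhs q)] --> +oo).

Let du x : O x -> differentiable u x.
Proof. by move=> Ox; case: (C2 _ Ox). Qed.

Let dp x : O x -> differentiable ('D_e1 u) x.
Proof. by move=> Ox; case: (C2 _ Ox) => _ [h _]; apply: h; rewrite inE eqxx. Qed.

Let dq x : O x -> differentiable ('D_e2 u) x.
Proof. by move=> Ox; case: (C2 _ Ox) => _ [h _]; apply: h; rewrite !inE eqxx orbT. Qed.

Let su : subgradient R O u ('D_e1 u) ('D_e2 u).
Proof. exact: convex_subgradient. Qed.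

Lemma gradient_monotone x y : O x -> O y -> 0 <= dotdiff R ('D_e1 u) ('D_e2 u) x y.
Proof. by move=> Ox Oy; exact: subgradient_monotone su Ox Oy. Qed.

Lemma gradient_expansion x : O x -> expansion_at R O K ('D_e1 u) ('D_e2 u) x.
Proof.
move=> Ox.
have [r r0 rO] : exists2 r, 0 < r & forall y, dist1 R x y < r -> O y.
  have /nbhs_ballP[r /= r0 rO] := open_nbhs_nbhs (conj oO Ox).
  exists r => // y yr; apply: rO; split; rewrite /ball /= distrC; apply: le_lt_trans yr.
    by rewrite /dist1 lerDl.
  by rewrite /dist1 lerDr.
have sym := mixed_partials_comm R u r x r0 (fun y yr => du y (rO y yr)) (dp x Ox) (dq x Ox).
have detE := det_of_curvature _ _ _ _ _ _ _ (gc x Ox).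
apply: (expansion_of_derivatives _ _ _ _ _ _ _ _ _ r K0 r0 rO detE).
- by move=> y Oy; exact: gradient_monotone.
- by move=> e e0; exact: differentiable_expansion (dp x Ox) e0.
- by move=> e e0; rewrite sym; exact: differentiable_expansion (dq x Ox) e0.
Qed.

(** Points whose gradients tend to $(s,t)$ cluster, as the domain is bounded. A cluster point inside
    attains the value by continuity; one on the boundary contradicts the blow-up of the gradient. *)
Lemma gradient_closed_range : closed_range R O ('D_e1 u) ('D_e2 u).
Proof.
move=> s t.
pose dd x := `|'D_e1 u x - s| + `|'D_e2 u x - t|.
have [//|nrg] := pselect (exists2 x, O x & 'D_e1 u x = s /\ 'D_e2 u x = t); first by left.
right; apply: contrapT => nex.
have ex (n : nat) : exists x, O x /\ dd x < n.+1%:R^-1.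
  apply: contrapT => nx; apply: nex; exists n.+1%:R^-1; first by rewrite invr_gt0.
  by move=> x Ox; rewrite leNgt; apply/negP => h; apply: nx; exists x.
have [X hX] := choice ex.
have cC : compact (`[- L, L]%classic `*` `[- L, L]%classic : set (R * R)).
  by apply: compact_setX; exact: segment_compact.
have FC : (X @ \oo) (`[- L, L]%classic `*` `[- L, L]%classic : set (R * R)).
  exists 0%N => // n _ /=; have [OX _] := hX n.
  have [h1 h2] : `|(X n).1| <= L /\ `|(X n).2| <= L by apply: bO; rewrite -surjective_pairing.
  by rewrite !in_itv /= -!ler_norml.
have [z [_ clz]] := cC _ _ FC.
have FE e : 0 < e -> (X @ \oo) [set x | O x /\ dd x < e].
  move=> e0; exists (Num.truncn e^-1) => // n /= hn; have [OX dX] := hX n; split => //.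
  apply: (lt_le_trans dX); rewrite invf_ple ?posrE //.
  by apply: le_trans (ltW (truncnS_gt _)) _; rewrite ler_nat ltnS.
have [Oz|nOz] := pselect (O z).
  suff dz : dd z <= 0.
    apply: nrg; exists z => //.
    have : dd z == 0 by rewrite eq_le dz addr_ge0.
    by rewrite paddr_eq0 // !normr_eq0 !subr_eq0 => /andP[/eqP -> /eqP ->].
  apply/ler_addgt0Pr => e e0; rewrite add0r leNgt; apply/negP => edz.
  have cd : {for z, continuous dd}.
    apply: continuousD; (apply: (@continuous_comp _ _ _ _ (fun x : R => `|x|)); last exact: norm_continuous);
    (apply: continuousB; last exact: cst_continuous); apply: differentiable_continuous;
    [exact: dp|exact: dq].
  have nz : nbhs z [set x | e < dd x] by exact: (cvgr_gt _ cd _ edz).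
  have [x [[_ h1] /= h2]] := clz _ _ (FE e e0) nz.
  by have := lt_trans h1 h2; rewrite ltxx.
have clO : closure O z.
  by move=> B nB; have [x [[Ox _] Bx]] := clz _ _ (FE 1 ltr01) nB; exists x.
have := bd z clO nOz => /cvgryPgt /(_ (`|s| + `|t| + 1)) nB.
have nB' : nbhs z [set x | O x -> `|s| + `|t| + 1 < gradnorm u x] by exact: nB.
have [x [[Ox h1] /= /(_ Ox)]] := clz _ _ (FE 1 ltr01) nB'.
apply/negP; rewrite -leNgt.
have ps : `|'D_e1 u x| <= `|'D_e1 u x - s| + `|s|.
  by rewrite -{1}['D_e1 u x](subrK s); exact: ler_normD.
have qt : `|'D_e2 u x| <= `|'D_e2 u x - t| + `|t|.
  by rewrite -{1}['D_e2 u x](subrK t); exact: ler_normD.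
apply: (@le_trans _ _ (`|'D_e1 u x| + `|'D_e2 u x|)); last first.
  by move: h1; rewrite /dd; lra.
have nn : 0 <= `|'D_e1 u x| + `|'D_e2 u x| by rewrite addr_ge0.
rewrite /gradnorm -[X in _ <= X](ger0_norm nn) -sqrtr_sqr ler_wsqrtr //.
rewrite sqrrD !real_normK ?num_real // -addrA lerD2l lerDr.
by rewrite mulrn_wge0 // mulr_ge0.
Qed.

Lemma gradient_curvature_map : curvature_map R O K ('D_e1 u) ('D_e2 u).
Proof.
by split; [exact: gradient_expansion|exact: gradient_monotone|exact: gradient_closed_range].
Qed.

End GradientMap.

(** * Invariance under reflections *)

Section Reflection.
Variable R : realType.
Variables (O : set (R * R)) (K s1 s2 : R) (p q u : R * R -> R).
Hypotheses (s11 : s1 * s1 = 1) (s22 : s2 * s2 = 1).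
Let refl (z : R * R) : R * R := (s1 * z.1, s2 * z.2).
Hypothesis symO : forall z, O z -> O (refl z).

Let norm_sign (s x : R) : s * s = 1 -> `|s * x| = `|x|.
Proof.
move=> ss; have : `|s| ^+ 2 = 1 by rewrite real_normK ?num_real // expr2.
move=> /eqP; rewrite sqrf_eq1 => /orP[/eqP h|/eqP h]; first by rewrite normrM h mul1r.
by have := normr_ge0 s; rewrite h oppr_ge0 ler10.
Qed.

Let dist_refl x y : dist1 R (refl x) (refl y) = dist1 R x y.
Proof. by rewrite /dist1 /= -!mulrBr !norm_sign. Qed.

(** The Jacobian is conjugated by the diagonal matrix of signs: only $b$ changes, to $s_1 s_2 b$, so
    determinant and density are kept. *)
Lemma curvature_map_refl : curvature_map R O K p q ->
  curvature_map R O K (fun z => s1 * p (refl z)) (fun z => s2 * q (refl z)).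
Proof.
case=> hE hM hC; split.
- move=> x Ox; have [a [b [d [a0 D he]]]] := hE _ (symO x Ox).
  exists a, (s1 * s2 * b), d; split => //.
    have -> : dens R (s1 * p (refl x)) (s2 * q (refl x)) = dens R (p (refl x)) (q (refl x)).
      by rewrite /dens !exprMn !expr2 s11 s22 !mul1r.
    have -> : (s1 * s2 * b) ^+ 2 = (s1 * s1) * (s2 * s2) * b ^+ 2 by ring.
    by rewrite s11 s22 !mul1r.
  move=> e e0; have [r r0 hr] := he e e0; exists r => // y Oy xy.
  have [h1 h2] := hr _ (symO y Oy) ltac:(by rewrite dist_refl).
  rewrite dist_refl in h1 h2; split.
    rewrite -(norm_sign s1 _ s11); apply: le_trans h1; rewrite le_eqVlt; apply/orP; left.
    apply/eqP; congr (`|_|); rewrite /refl /=.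
    have -> : s1 * (s1 * p (refl y) - s1 * p (refl x) -
       (a * (y.1 - x.1) + s1 * s2 * b * (y.2 - x.2))) =
      s1 * s1 * (p (refl y) - p (refl x)) - (a * (s1 * (y.1 - x.1)) + s1 * s1 * s2 * b * (y.2 - x.2)).
      by ring.
    by rewrite s11 /refl; ring.
  rewrite -(norm_sign s2 _ s22); apply: le_trans h2; rewrite le_eqVlt; apply/orP; left.
  apply/eqP; congr (`|_|); rewrite /refl /=.
  have -> : s2 * (s2 * q (refl y) - s2 * q (refl x) -
     (s1 * s2 * b * (y.1 - x.1) + d * (y.2 - x.2))) =
    s2 * s2 * (q (refl y) - q (refl x)) - (s2 * s2 * s1 * b * (y.1 - x.1) + d * (s2 * (y.2 - x.2))).
    by ring.
  by rewrite s22 /refl; ring.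
- move=> x y Ox Oy; have := hM _ _ (symO x Ox) (symO y Oy); rewrite /dotdiff /=.
  by congr (_ <= _); rewrite /refl /=; ring.
- move=> s t; have [[x Ox [ps qt]]|[e e0 he]] := hC (s1 * s) (s2 * t).
    left; exists (refl x); first exact: symO.
    have -> : refl (refl x) = x.
      by rewrite /refl /= !mulrA s11 s22 !mul1r -surjective_pairing.
    by rewrite ps qt !mulrA s11 s22 !mul1r.
  right; exists e => // x Ox; apply: (le_trans (he _ (symO x Ox))).
  have E (sg a b : R) : sg * sg = 1 -> `|sg * a - b| = `|a - sg * b|.
    by move=> h; rewrite -(norm_sign sg _ h) mulrBr mulrA h mul1r.
  by rewrite !E.
Qed.

Lemma subgradient_refl : subgradient R O u p q ->
  subgradient R O (u \o refl) (fun z => s1 * p (refl z)) (fun z => s2 * q (refl z)).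
Proof.
move=> su x y Ox Oy; have := su _ _ (symO x Ox) (symO y Oy); rewrite /refl /=.
by congr (_ + _ <= _); ring.
Qed.

Lemma continuous_refl x : {for refl x, continuous u} -> {for x, continuous (u \o refl)}.
Proof.
move=> cu; apply: continuous_comp => //.
apply: (@cvg_pair _ _ _ _ (nbhs (s1 * x.1)) (nbhs (s2 * x.2))).
  by apply: continuousM; [exact: cst_continuous|exact: cvg_fst].
by apply: continuousM; [exact: cst_continuous|exact: cvg_snd].
Qed.

End Reflection.

(** * The estimate in the first quadrant *)

Lemma angle_primC (R : realType) (s t : R) : angle_prim R s t = angle_prim R t s.
Proof. by rewrite /angle_prim (mulrC s) -!addrA (addrC (s ^+ 2)). Qed.

Lemma angle_rectC (R : realType) (a b c d : R) :
  angle_rect R a b c d = angle_rect R c d a b.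
Proof.
rewrite /angle_rect (angle_primC R c) (angle_primC R c) (angle_primC R d).
by rewrite (angle_primC R d); ring.
Qed.

(** * Slope layers on a single column *)

Section ColumnLayers.
Variables (R : realType) (phi psi : R -> R) (T : nat -> R) (L : nat -> set R).
Variables (a0 b0 : R).
Local Notation lam := (@lebesgue_measure R).
Hypotheses (T0 : forall k, 0 < T k)
  (sub : forall y z, a0 <= y <= b0 -> a0 <= z <= b0 ->
     phi y + psi y * (z - y) <= phi z)
  (cpsi : {within `[a0, b0], continuous psi})
  (spsi : forall y z, a0 <= y -> y < z -> z <= b0 -> psi y < psi z)
  (mL : forall k, measurable (L k : set (measurableTypeR R)))
  (hL : forall k y, a0 <= y <= b0 -> T k < psi y <= T k.+1 -> L k y).

(** The part of the interval with slope at most [T 0] contributes at most its length times [T 0],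
    and each layer its length times its largest slope. Extended reals are used because the bound is
    integrated over columns afterwards. *)
Lemma increment_le_layers n b : a0 <= b <= b0 -> psi b <= T n ->
  ((phi b - phi a0)%:E <= ((b - a0) * T 0)%:E +
    \sum_(k < n) ((T k.+1)%:E * lam (`[a0, b]%classic `&` L k)))%E.
Proof.
elim: n b => [|n IH] b /andP[ab bb] pb.
  rewrite big_ord0 adde0 lee_fin.
  have := sub b a0 ltac:(by rewrite ab) ltac:(by rewrite lexx (le_trans ab)).
  have : psi b * (b - a0) <= T 0 * (b - a0) by rewrite ler_wpM2r // subr_ge0.
  by rewrite mulrC; lra.
have nneg k (A : set R) : (0 <= (T k.+1)%:E * lam A)%E.
  by rewrite mule_ge0 // lee_fin ltW.
rewrite big_ord_recr /=.
have mI c k : measurable (`[a0, c]%classic `&` L k : set (measurableTypeR R)).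
  by apply: measurableI; [exact: measurable_itv|exact: mL].
have [pbn|pbn] := leP (psi b) (T n).
  apply: (le_trans (IH b ltac:(by rewrite ab) pbn)).
  by rewrite addeA leeDl.
have step c : a0 <= c -> c <= b -> `]c, b]%classic `<=` L n ->
    ((phi b - phi c)%:E <= (T n.+1)%:E * lam (`[a0, b]%classic `&` L n))%E.
  move=> ac cb cL.
  apply: (@le_trans _ _ ((T n.+1)%:E * (b - c)%:E)%E).
    rewrite -EFinM lee_fin.
    have := sub b c ltac:(by rewrite ab) ltac:(by rewrite ac (le_trans cb)).
    have : psi b * (b - c) <= T n.+1 * (b - c) by rewrite ler_wpM2r // subr_ge0.
    by lra.
  apply: lee_pmul => //; first by rewrite lee_fin ltW.
    by rewrite lee_fin subr_ge0.
  have -> : ((b - c)%:E = lam `]c, b]%classic)%E.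
    rewrite lebesgue_measure_itv /= lte_fin; case: ltP => //.
    by move=> bc; have -> : b = c; [apply/eqP; rewrite eq_le bc cb|rewrite subrr].
  apply: le_measure; rewrite ?inE; [exact: measurable_itv|exact: mI|].
  move=> y yc; split; last exact: cL.
  by move: yc; rewrite /= !in_itv /= => /andP[h1 ->]; rewrite (le_trans ac) // ltW.
(* Either the slope exceeds [T n] from the start and the whole interval lies in the last layer, or
   it takes the value [T n] at some [c], which splits the interval between induction and the last
   layer. *)
have [pa|pa] := leP (psi a0) (T n); last first.
  have cL : `]a0, b]%classic `<=` L n.
    move=> y; rewrite /= in_itv /= => /andP[ay yb].
    apply: hL; first by rewrite (ltW ay) (le_trans yb).
    rewrite (lt_trans pa) ?spsi // ?(le_trans yb) //=.
    move: yb; rewrite le_eqVlt => /orP[/eqP ->//|yb].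
    by rewrite (le_trans _ pb) // ltW // spsi // ltW.
  apply: (le_trans (step a0 (lexx _) ab cL)).
  rewrite addeA leeDr // adde_ge0 ?sume_ge0 //.
  by rewrite lee_fin mulr_ge0 ?subr_ge0 // ltW.
have cab : {within `[a0, b], continuous psi}.
  apply: continuous_subspaceW cpsi => y; rewrite /= !in_itv /= => /andP[-> h].
  exact: le_trans h bb.
have [c] := @IVT R psi a0 b (T n) ab cab ltac:(by rewrite ge_min pa le_max (ltW pbn) orbT).
rewrite in_itv /= => /andP[ac cb] pc.
have cL : `]c, b]%classic `<=` L n.
  move=> y; rewrite /= in_itv /= => /andP[cy yb].
  apply: hL; first by rewrite (le_trans ac (ltW cy)) (le_trans yb).
  rewrite -pc spsi ?(le_trans yb) //=.
  move: yb; rewrite le_eqVlt => /orP[/eqP ->//|yb].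
  by rewrite (le_trans _ pb) // ltW // spsi // (le_trans ac (ltW cy)).
have -> : ((phi b - phi a0)%:E = (phi c - phi a0)%:E + (phi b - phi c)%:E)%E.
  by rewrite -EFinD; congr (_%:E); ring.
rewrite addeA; apply: leeD; last exact: step.
apply: (le_trans (IH c ltac:(by rewrite ac (le_trans cb)) ltac:(by rewrite pc))).
apply: leeD; first by rewrite lee_fin ler_wpM2r ?(ltW (T0 0)) // lerD2r.
apply: lee_sum => k _; apply: lee_pmul => //; first by rewrite lee_fin ltW.
apply: le_measure; rewrite ?inE //.
by move=> y []; rewrite /= !in_itv /= => /andP[-> h] ?; rewrite (le_trans h).
Qed.

End ColumnLayers.

(** * Areas of sets with large slope, and the corner *)

Section AreaBounds.
Variable R : realType.
Local Notation plane := (measurableTypeR R * measurableTypeR R)%type.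
Variables (O : set (R * R)) (K : R) (p q : R * R -> R).
Hypotheses (oO : open O) (K0 : 0 < K)
  (cO : forall x y t, O x -> O y -> 0 <= t <= 1 -> O (t *: x + (1 - t) *: y))
  (finO : (lam2 O < +oo)%E)
  (cm : curvature_map R O K p q).

Lemma lam2_le_mass (E : set plane) a b c d : measurable E -> E `<=` box R O p q a b c d ->
  fine (lam2 E) <= mass R O p q a b c d.
Proof.
move=> mE sE.
have EO : E `<=` O by move=> z /sE[].
apply: fine_le; [exact: (lam2_fin R O oO finO)|exact: (box_fin R O K p q oO finO cm)|].
by apply: le_measure; rewrite ?inE //; exact: (measurable_box R O K p q oO cm).
Qed.

Lemma area_slab_le (E : set plane) (M T U : R) : measurable E -> 0 < M -> 0 < T -> T < U ->
  (forall z, E z -> [/\ O z, 0 < p z <= M & T < q z <= U]) ->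
  K * fine (lam2 E) <= M * (U - T) / T ^+ 3.
Proof.
move=> mE M0 T0 TU hE.
apply: le_trans (angle_rect_slab_le R _ _ _ M0 T0 TU).
apply: le_trans (mass_le R O K p q oO K0 cO finO cm _ _ _ _ M0 TU).
by rewrite ler_pM2l //; apply: lam2_le_mass => // z /hE[].
Qed.

(** Mass is compared with solid angle on bounded rectangles only; continuity from below removes the
    upper bounds on the slopes. *)
Lemma area_truncate_le (E : set plane) (c : R) (t : R) : measurable E -> E `<=` O ->
  (forall n : R, t < n -> K * fine (lam2 (E `&` [set z | p z <= n /\ q z <= n])) <= c) ->
  K * fine (lam2 E) <= c.
Proof.
move=> mE EO hc.
have mp := measurable_preimage_map R O K p q oO cm.
pose B (n : nat) : set plane := E `&` [set z | p z <= n%:R /\ q z <= n%:R].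
have mB n : measurable (B n).
  have -> : B n = E `&` (O `&` [set z | (`]-oo, n%:R]%classic `*` `]-oo, n%:R]%classic) (p z, q z)]).
    apply/seteqP; split => z; rewrite /B /= !in_itv /=; last by case=> Ez [_].
    by case=> Ez h; split => //; split => //; exact: EO.
  by apply: measurableI => //; apply: mp; apply: measurableX; exact: measurable_itv.
have UB : \bigcup_n B n = E.
  apply/seteqP; split => [z [n _ []]//|z Ez].
  exists (Num.truncn (`|p z| + `|q z|)).+1 => //; split => //=.
  have := truncnS_gt (`|p z| + `|q z|); set n := (_.+1)%:R => Mn.
  have pp := ler_norm (p z); have qq := ler_norm (q z).
  have np := normr_ge0 (p z); have nq := normr_ge0 (q z).
  by split; lra.
have cvgB : (lam2 \o B) n @[n --> \oo] --> lam2 E.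
  rewrite -UB; apply: nondecreasing_cvg_mu => //; first by rewrite UB.
  move=> n m nm; apply/subsetPset => z [Ez [h1 h2]]; split => //=.
  have nm' : n%:R <= m%:R :> R by rewrite ler_nat.
  by split; [exact: le_trans h1 nm'|exact: le_trans h2 nm'].
have finE : lam2 E \is a fin_num by exact: (lam2_fin R O oO finO).
have cvgF : (fine \o (lam2 \o B)) n @[n --> \oo] --> fine (lam2 E).
  by apply: fine_cvg; rewrite fineK.
rewrite mulrC -ler_pdivlMr // leNgt; apply/negP => lt.
have [N _ hN] : \forall n \near \oo, c / K < (fine \o (lam2 \o B)) n.
  exact: (cvgr_gt _ cvgF _ lt).
pose m := maxn N (Num.truncn t).+1.
have := hN m (leq_maxl _ _) => /=; apply/negP; rewrite -leNgt ler_pdivlMr // mulrC.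
by apply: hc; apply: lt_le_trans (truncnS_gt t) _; rewrite ler_nat leq_maxr.
Qed.

Lemma area_strip_le (E : set plane) (t : R) : measurable E -> 0 < t ->
  (forall z, E z -> [/\ O z, t <= p z & 0 < q z]) \/
  (forall z, E z -> [/\ O z, t <= q z & 0 < p z]) ->
  K * fine (lam2 E) * t <= 1.
Proof.
move=> mE t0 hE.
have EO : E `<=` O by move=> z Ez; case: hE => /(_ z Ez)[].
(* Boxes are open on the left, so the level [t] is reached as a limit of levels [s < t]. *)
have key s : 0 < s -> s < t -> K * fine (lam2 E) * s <= 1.
  move=> s0 st; rewrite -ler_pdivlMr // div1r.
  apply: (area_truncate_le E _ s) => // n sn.
  have n0 := lt_trans s0 sn.
  have mE' : measurable (E `&` [set z | p z <= n /\ q z <= n] : set plane).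
    have -> : E `&` [set z | p z <= n /\ q z <= n] =
      E `&` (O `&` [set z | (`]-oo, n]%classic `*` `]-oo, n]%classic) (p z, q z)]).
      apply/seteqP; split => z; rewrite /= !in_itv /=; last by case=> Ez [_].
      by case=> Ez h; split => //; split => //; exact: EO.
    apply: measurableI => //; apply: (measurable_preimage_map R O K p q oO cm).
    by apply: measurableX; exact: measurable_itv.
  apply: le_trans (angle_rect_strip_le R _ _ s0 sn).
  case: hE => hE.
    apply: le_trans (mass_le R O K p q oO K0 cO finO cm _ _ _ _ sn n0).
    rewrite ler_pM2l //; apply: lam2_le_mass => // z [Ez /= [pn qn]].
    have [Oz tp q0] := hE z Ez; split => //=.
    by rewrite pn qn q0 (lt_le_trans st tp).
  rewrite angle_rectC.
  apply: le_trans (mass_le R O K p q oO K0 cO finO cm _ _ _ _ n0 sn).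
  rewrite ler_pM2l //; apply: lam2_le_mass => // z [Ez /= [pn qn]].
  have [Oz tp q0] := hE z Ez; split => //=.
  by rewrite pn qn q0 (lt_le_trans st tp).
set A := K * fine (lam2 E) in key *.
rewrite leNgt; apply/negP => At.
have A0 : 0 < A by rewrite -(pmulr_lgt0 _ t0) (lt_trans _ At).
have At' : A^-1 < t by rewrite -div1r ltr_pdivrMr // mulrC.
have Ai : 0 < A^-1 by rewrite invr_gt0.
have := key ((A^-1 + t) / 2) ltac:(by lra) ltac:(by lra).
apply/negP; rewrite -ltNge mulrC -ltr_pdivrMr // div1r; lra.
Qed.

Variable u : R * R -> R.
Hypotheses (su : subgradient R O u p q)
  (sqO : forall x y : R, -1 <= x <= 1 -> -1 <= y <= 1 -> O (x, y))
  (sx : forall z, O z -> p (- z.1, z.2) = - p z /\ q (- z.1, z.2) = q z)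
  (sy : forall z, O z -> p (z.1, - z.2) = p z /\ q (z.1, - z.2) = - q z).

Let strict := curvature_map_strict R O K p q K0 cO cm.

(** By oddness of [p] in $x$, strict monotonicity between a point and its mirror image reads $4xp >
    0$. *)
Lemma p_gt0 x y : 0 < x <= 1 -> -1 <= y <= 1 -> 0 < p (x, y).
Proof.
move=> /andP[x0 x1] y1.
have O1 : O (x, y) by apply: sqO => //; lra.
have O2 : O (- x, y) by apply: sqO => //; lra.
have [h1 h2] := sx _ O1; rewrite /= in h1 h2.
have ne : (- x, y) != (x, y) by apply/eqP => -[]; lra.
have := strict _ _ O2 O1 ne; rewrite /dotdiff /= h1 h2.
have -> : (p (x, y) - - p (x, y)) * (x - - x) + (q (x, y) - q (x, y)) * (y - y) =
  p (x, y) * (4 * x) by ring.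
by rewrite pmulr_lgt0 // mulr_gt0.
Qed.

Lemma q_gt0 x y : -1 <= x <= 1 -> 0 < y <= 1 -> 0 < q (x, y).
Proof.
move=> x1 /andP[y0 y1].
have O1 : O (x, y) by apply: sqO => //; lra.
have O2 : O (x, - y) by apply: sqO => //; lra.
have [h1 h2] := sy _ O1; rewrite /= in h1 h2.
have ne : (x, - y) != (x, y) by apply/eqP => -[]; lra.
have := strict _ _ O2 O1 ne; rewrite /dotdiff /= h1 h2.
have -> : (p (x, y) - p (x, y)) * (x - x) + (q (x, y) - - q (x, y)) * (y - - y) =
  q (x, y) * (4 * y) by ring.
by rewrite pmulr_lgt0 // mulr_gt0.
Qed.

Lemma p_ge0 x y : 0 <= x <= 1 -> -1 <= y <= 1 -> 0 <= p (x, y).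
Proof.
move=> /andP[]; rewrite le_eqVlt => /orP[/eqP <- _ y1|x0 x1 y1]; last first.
  by rewrite ltW // p_gt0 // x0.
have O1 : O (0, y) by apply: sqO => //; lra.
by have [] := sx _ O1; rewrite /= oppr0 => h _; lra.
Qed.

Lemma u_mono x y x' y' : 0 < x -> 0 < y -> x <= x' <= 1 -> y <= y' <= 1 ->
  u (x, y) <= u (x', y').
Proof.
move=> x0 y0 xx yy.
have O1 : O (x, y) by apply: sqO => //; lra.
have O2 : O (x', y') by apply: sqO => //; lra.
have := su _ _ O1 O2 => /=.
have p0 : 0 <= p (x, y) by apply: p_ge0; lra.
have q0 : 0 < q (x, y) by apply: q_gt0; lra.
have P0 : 0 <= p (x, y) * (x' - x) by rewrite mulr_ge0 // subr_ge0; lra.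
have Q0 : 0 <= q (x, y) * (y' - y) by rewrite mulr_ge0 ?(ltW q0) // subr_ge0; lra.
lra.
Qed.

Let rect (a b c d : R) : set plane := `[a, b]%classic `*` `[c, d]%classic.

Let mrect a b c d : measurable (rect a b c d).
Proof. by apply: measurableX; exact: measurable_itv. Qed.

Let area_rect a b c d : a <= b -> c <= d -> fine (lam2 (rect a b c d)) = (b - a) * (d - c).
Proof. by move=> ab cd; rewrite lam2_rectangle. Qed.

(** On the square of side $s$ at the corner, the supporting plane evaluated at the origin gives $p +
    q \ge N$, so one slope is at least $N/2$. Two strip bounds then yield $K s^2 N/2 \le 2$. *)
Lemma corner_bound s : 0 < s < 1 ->
  u (1 - s, 1 - s) - u (0, 0) <= 4 / (K * s ^+ 2).
Proof.
move=> /andP[s0 s1]; set N := u _ - _.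
have s20 : 0 < s ^+ 2 by rewrite exprn_gt0.
have [N0|N0] := leP N 0; first by apply: le_trans N0 _; rewrite divr_ge0 ?mulr_ge0 ?ltW.
pose E := rect (1 - s) 1 (1 - s) 1.
have EO z : E z -> [/\ O z, 0 < z.1 <= 1 & 0 < z.2 <= 1].
  case: z => x y [/=]; rewrite !in_itv /= => h1 h2; split; [apply: sqO|..]; lra.
have pqN z : E z -> N <= p z + q z.
  case: z => x y Ez; have [Oz /= x01 y01] := EO _ Ez.
  have O0 : O (0, 0) by apply: sqO; lra.
  have h1 := su _ _ Oz O0; rewrite /= !sub0r in h1.
  have [/=] := Ez; rewrite !in_itv /= => hx hy.
  have h2 : u (1 - s, 1 - s) <= u (x, y) by apply: u_mono => //; lra.
  have P0 : 0 < p (x, y) by apply: p_gt0 => //; lra.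
  have Q0 : 0 < q (x, y) by apply: q_gt0 => //; lra.
  have Px : p (x, y) * x <= p (x, y) by rewrite ler_piMr ?(ltW P0); lra.
  have Qy : q (x, y) * y <= q (x, y) by rewrite ler_piMr ?(ltW Q0); lra.
  by rewrite /N; lra.
have N20 : 0 < N / 2 by rewrite divr_gt0.
have mp := measurable_preimage_map R O K p q oO cm.
pose E1 : set plane := E `&` (O `&` [set z | (`[N / 2, +oo[%classic `*` setT) (p z, q z)]).
pose E2 : set plane := E `&` (O `&` [set z | (setT `*` `[N / 2, +oo[%classic) (p z, q z)]).
have mE1 : measurable E1.
  by apply: measurableI; [exact: mrect|apply: mp; apply: measurableX].
have mE2 : measurable E2.
  by apply: measurableI; [exact: mrect|apply: mp; apply: measurableX].
have h1 : K * fine (lam2 E1) * (N / 2) <= 1.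
  apply: area_strip_le => //; left => z [Ez [Oz [/=]]]; rewrite in_itv /= andbT => h _.
  by have [_ x01 y01] := EO z Ez; split => //; rewrite [z]surjective_pairing q_gt0 //; lra.
have h2 : K * fine (lam2 E2) * (N / 2) <= 1.
  apply: area_strip_le => //; right => z [Ez [Oz [/= _]]]; rewrite in_itv /= andbT => h.
  by have [_ x01 y01] := EO z Ez; split => //; rewrite [z]surjective_pairing p_gt0 //; lra.
have h3 : s ^+ 2 <= fine (lam2 E1) + fine (lam2 E2).
  have -> : s ^+ 2 = fine (lam2 E).
    by rewrite area_rect; [ring|lra|lra].
  have f1 : lam2 E1 \is a fin_num by apply: (lam2_fin R O oO finO) => // z [_ []].
  have f2 : lam2 E2 \is a fin_num by apply: (lam2_fin R O oO finO) => // z [_ []].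
  rewrite -fineD //; apply: fine_le.
  - by apply: (lam2_fin R O oO finO); [exact: mrect|move=> z /EO[]].
  - by rewrite fin_numD f1.
  apply: (@le_trans _ _ (lam2 (E1 `|` E2))); last exact: measureU2.
  apply: le_measure; rewrite ?inE; [exact: mrect|exact: measurableU|].
  move=> z Ez; have [Oz _ _] := EO z Ez; have := pqN z Ez.
  have [pz|pz] := leP (N / 2) (p z) => pq; [left|right]; split => //; split => //;
    split => //=; rewrite in_itv /= andbT //; lra.
rewrite ler_pdivlMr ?mulr_gt0 //.
have h4 : K * s ^+ 2 * (N / 2) <= 2.
  apply: (@le_trans _ _ (K * (fine (lam2 E1) + fine (lam2 E2)) * (N / 2))).
    by rewrite ler_pM2r // ler_pM2l.
  by rewrite mulrDr mulrDl; lra.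
lra.
Qed.

(** A large slope [p] at a point persists on a rectangle to its lower right, whose area the strip
    bound limits. The conditions on [x] and [y] keep that rectangle in the part of the square where
    [q] is positive. *)
Lemma p_bound a x y M : 0 < a < 1 -> 0 <= x <= 1 - a / 2 -> 1 / 2 <= y <= 1 -> 0 <= M ->
  32 / (K * a ^+ 2) <= M -> 64 / (K * a ^+ 2) * q (x, y) <= M ^+ 2 -> p (x, y) <= M.
Proof.
move=> /andP[a0 a1] xb yb M0 M1 M2.
have O1 : O (x, y) by apply: sqO => //; lra.
have P0 : 0 <= p (x, y) by apply: p_ge0; lra.
have Q0 : 0 < q (x, y) by apply: q_gt0; lra.
set P := p (x, y) in P0 *; set Q := q (x, y) in Q0 M2.
have Ka : 0 < K * a ^+ 2 by rewrite mulr_gt0 // exprn_gt0.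
have [P00|Pp] := leP P 0; first exact: le_trans P00 M0.
(* [k] is the ratio of the height of the rectangle to its width. Moving right by $t$ and down by at
   most $kt$, monotonicity loses at most $kQ \le P/2$ of the slope; the area is $ka^2/16$. *)
have key k : 0 < k <= 1 -> 2 * k * Q <= P -> k * P <= 32 / (K * a ^+ 2).
  move=> /andP[k0 k1] kQ.
  have ka0 : 0 < k * a by rewrite mulr_gt0.
  have ka1 : k * a <= a by rewrite ler_piMl ?(ltW a0).
  pose E := rect (x + a / 4) (x + a / 2) (y - k * a / 4) y.
  have P20 : 0 < P / 2 by rewrite divr_gt0.
  have hE z : E z -> [/\ O z, P / 2 <= p z & 0 < q z].
    case: z => z1 z2 [/=]; rewrite !in_itv /= => h1 h2.
    have Oz : O (z1, z2) by apply: sqO; lra.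
    have qz : 0 < q (z1, z2) by apply: q_gt0; lra.
    split => //.
    case: cm => _ /(_ _ _ O1 Oz) + _; rewrite /dotdiff /= -/P -/Q.
    set t := z1 - x; set s := y - z2.
    have -> : z2 - y = - s by rewrite /s; ring.
    have t0 : 0 < t by rewrite /t; lra.
    have tE : a / 4 <= t by rewrite /t; lra.
    have s0 : 0 <= s by rewrite /s; lra.
    have sE : s <= k * t.
      apply: (@le_trans _ _ (k * (a / 4))); first by rewrite /s; lra.
      by rewrite ler_pM2l.
    have e1 : Q * s <= P * t / 2.
      apply: (@le_trans _ _ (Q * (k * t))); first by rewrite ler_pM2l.
      have : (2 * k * Q) * t <= P * t by rewrite ler_pM2r.
      lra.
    have e2 : 0 <= q (z1, z2) * s by rewrite mulr_ge0 // ltW.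
    move=> mono; rewrite -(ler_pM2r t0); lra.
  have := area_strip_le E (P / 2) (mrect _ _ _ _) P20 (or_introl hE).
  rewrite area_rect; [|lra|lra].
  rewrite ler_pdivlMr //.
  have -> : K * ((x + a / 2 - (x + a / 4)) * (y - (y - k * a / 4))) * (P / 2) =
     k * P * (K * a ^+ 2) / 32 by field.
  lra.
have [QP|QP] := leP (2 * Q) P.
  by have := key 1 ltac:(by rewrite ltr01 lexx) ltac:(by lra); lra.
(* The largest ratio [key] admits; it turns the bound into one on $P^2/(2Q)$. *)
pose k := P / (2 * Q).
have Q20 : 0 < 2 * Q by rewrite mulr_gt0.
have k0 : 0 < k by rewrite divr_gt0.
have k1 : k <= 1 by rewrite ler_pdivrMr // mul1r ltW.
have := key k ltac:(by rewrite k0) ltac:(by rewrite /k; have -> : 2 * (P / (2 * Q)) * Q = P by field; rewrite gt_eqF).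
have -> : k * P = P ^+ 2 / (2 * Q) by rewrite /k; field; rewrite gt_eqF.
rewrite ler_pdivrMr // => h.
rewrite -(@ler_pXn2r _ 2) ?nnegrE //; apply: le_trans M2.
by apply: le_trans h _; rewrite le_eqVlt; apply/orP; left; apply/eqP; field; rewrite !gt_eqF.
Qed.

End AreaBounds.

(** * The increment up to the edge *)

Lemma sum_half_le (R : realType) n : \sum_(k < n) (2^-1 : R) ^+ k <= 2.
Proof.
suff -> : \sum_(k < n) (2^-1 : R) ^+ k = 2 - 2 * 2^-1 ^+ n.
  by rewrite gerBl mulr_ge0 // exprn_ge0 // invr_ge0.
elim: n => [|n IH]; first by rewrite big_ord0 expr0 mulr1 subrr.
by rewrite big_ord_recr /= IH exprS; field.
Qed.

Section EdgeEstimate.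
Variable R : realType.
Local Notation lam := (@lebesgue_measure R).
Local Notation plane := (measurableTypeR R * measurableTypeR R)%type.
Variables (O : set (R * R)) (K : R) (p q u : R * R -> R).
Hypotheses (oO : open O) (K0 : 0 < K)
  (cO : forall x y t, O x -> O y -> 0 <= t <= 1 -> O (t *: x + (1 - t) *: y))
  (finO : (lam2 O < +oo)%E)
  (cm : curvature_map R O K p q)
  (su : subgradient R O u p q)
  (sqO : forall x y : R, -1 <= x <= 1 -> -1 <= y <= 1 -> O (x, y))
  (sx : forall z, O z -> p (- z.1, z.2) = - p z /\ q (- z.1, z.2) = q z)
  (sy : forall z, O z -> p (z.1, - z.2) = p z /\ q (z.1, - z.2) = - q z).

Let strict := curvature_map_strict R O K p q K0 cO cm.
Let cq x (Ox : O x) := (curvature_map_continuous R O K p q oO cm x Ox).2.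
Let ppos := p_gt0 R O K p q K0 cO cm sqO sx.
Let umono := u_mono R O K p q K0 cO cm u su sqO sx sy.

Lemma q_increasing x y z : -1 <= x <= 1 -> -1 <= y -> y < z -> z <= 1 ->
  q (x, y) < q (x, z).
Proof.
move=> x1 y1 yz z1.
have O1 : O (x, y) by apply: sqO => //; lra.
have O2 : O (x, z) by apply: sqO => //; lra.
have ne : (x, y) != (x, z) by apply/eqP => -[] e; rewrite e ltxx in yz.
have := strict _ _ O1 O2 ne; rewrite /dotdiff /= subrr mulr0 add0r.
by rewrite pmulr_lgt0 subr_gt0.
Qed.

Lemma q_column_continuous x a b : -1 <= x <= 1 -> -1 <= a -> b <= 1 ->
  {within `[a, b], continuous (fun y => q (x, y))}.
Proof.
move=> x1 a1 b1; apply: continuous_in_subspaceT => y; rewrite inE /= in_itv /= => yab.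
have Oxy : O (x, y) by apply: sqO => //; lra.
apply: (@continuous_comp _ _ _ (fun y : R => (x, y)) q); last exact: cq.
by apply: (@cvg_pair _ _ _ _ (nbhs x) (nbhs y)); [exact: cvg_cst|exact: cvg_id].
Qed.

Section Edge.
Variables (a : R) (a01 : 0 < a < 1).
Let B := 32 / (K * a ^+ 2).
(* [p_bound] gives $p \le 4 B 2^k$ where $q \le T_{k+1}$. *)
Let T k := 2 * B * 4 ^+ k.
Let E : set plane := `[1 - a, 1 - a / 2]%classic `*` `[1 - a / 2, 1]%classic.
Let layer k : set plane := E `&` (O `&` [set z | (setT `*` `]T k, T k.+1]%classic) (p z, q z)]).

Let a0 : 0 < a. Proof. by case/andP: a01. Qed.
Let B0 : 0 < B. Proof. by rewrite divr_gt0 // mulr_gt0 // exprn_gt0. Qed.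
Let T0 k : 0 < T k. Proof. by rewrite /T; apply: mulr_gt0; [apply: mulr_gt0|apply: exprn_gt0]. Qed.

Let EO z : E z -> [/\ O z, 0 < z.1 <= 1 - a / 2 & 1 / 2 <= z.2 <= 1].
Proof.
have /andP[h01 h11] := a01.
case: z => x y [/=]; rewrite !in_itv /= => h1 h2.
split => /=; [apply: sqO|..]; lra.
Qed.

Let mlayer k : measurable (layer k).
Proof.
apply: measurableI; first by apply: measurableX; exact: measurable_itv.
by apply: (measurable_preimage_map R O K p q oO cm); apply: measurableX => //; exact: measurable_itv.
Qed.

(** With $c = 2^k$ the slab bound for $M = 4Bc$, $T_k = 2Bc^2$, $T_{k+1} = 8Bc^2$ is $3/(Bc^3)$;
    multiplied by $T_{k+1}/K$ it leaves $24/(Kc)$. *)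
Let layer_area k : T k.+1 * fine (lam2 (layer k)) <= 24 / K * 2^-1 ^+ k.
Proof.
have h01 := a0; set c : R := 2 ^+ k; have c0 : 0 < c by rewrite exprn_gt0.
have c4 : 4 ^+ k = c ^+ 2 :> R by rewrite /c -exprM mulnC exprM; congr (_ ^+ _); ring.
have Tk : T k = 2 * B * c ^+ 2 by rewrite /T c4.
have TSk : T k.+1 = 8 * B * c ^+ 2 by rewrite /T exprS c4; ring.
have TT : T k < T k.+1.
  by rewrite Tk TSk ltr_pM2r ?exprn_gt0 // ltr_pM2r // ltr_nat.
have M0 : 0 < 4 * B * c by apply: mulr_gt0 => //; apply: mulr_gt0.
have := area_slab_le R O K p q oO K0 cO finO cm (layer k) (4 * B * c) (T k) (T k.+1)
  (mlayer k) M0 (T0 k) TT.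
have h z : layer k z -> [/\ O z, 0 < p z <= 4 * B * c & T k < q z <= T k.+1].
  move=> [Ez [Oz [/= _]]]; rewrite in_itv /= => /andP[q1 q2].
  have [_ z1 z2] := EO z Ez; rewrite q1 q2; split => //.
  rewrite [z]surjective_pairing ppos /=; [|lra|lra].
  apply: (p_bound R O K p q oO K0 cO finO cm sqO sx sy a) => //.
  - lra.
  - exact: ltW.
  - rewrite -/B; have c1 : 1 <= c by rewrite exprn_ege1 // ler1n.
    have : B * 1 <= B * c by rewrite ler_pM2l.
    have : 0 <= B * c by rewrite mulr_ge0 ?ltW.
    by lra.
  - have -> : 64 / (K * a ^+ 2) = 2 * B by rewrite /B; field; rewrite !gt_eqF.
    rewrite -surjective_pairing.
    apply: (@le_trans _ _ (2 * B * T k.+1)); first by rewrite ler_pM2l // mulr_gt0.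
    by rewrite TSk le_eqVlt; apply/orP; left; apply/eqP; ring.
move=> /(_ h) {}h.
have -> : 24 / K * 2^-1 ^+ k = T k.+1 / K * (4 * B * c * (T k.+1 - T k) / T k ^+ 3).
  rewrite TSk Tk exprVn -/c; field.
  by rewrite !gt_eqF.
rewrite -mulrA ler_pM2l // [leRHS]mulrC ler_pdivlMr // mulrC.
exact: h.
Qed.

(** [E] is a compact subset of [O], so finitely many layers suffice; their number does not enter the
    final bound. *)
Let q_bounded : exists n, forall z, E z -> q z <= T n.
Proof.
have cE : compact (E : set (R * R)) by apply: compact_setX; exact: segment_compact.
have wq : {within (E : set (R * R)), continuous q}.
  by apply: continuous_in_subspaceT => z; rewrite inE => /EO[Oz _ _]; exact: cq.
have [M [_ hM]] := compact_bounded (continuous_compact wq cE).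
have Mq z : E z -> q z <= `|M| + 1.
  move=> Ez; apply: (le_trans (ler_norm _)).
  by apply: (hM (`|M| + 1)); [rewrite ltr_pwDr // ler_norm|exists z].
pose n := (Num.truncn ((`|M| + 1) / (2 * B))).+1.
exists n => z /Mq h; apply: (le_trans h).
have B20 : 0 < 2 * B by apply: mulr_gt0.
rewrite /T mulrC -ler_pdivrMr //; apply: (le_trans (ltW (truncnS_gt _))).
by rewrite -/n -natrX ler_nat ltnW // ltn_expl.
Qed.

(** Since [u] increases in both variables and $1-a \le x \le 1-a/2$, the increment along each column
    dominates the one between the two fixed points. The lower bound is thus independent of [x]. *)
Let column x n : 1 - a <= x <= 1 - a / 2 -> (forall z, E z -> q z <= T n) ->
  ((u (1 - a, 1) - u (1 - a / 2, 1 - a / 2) - a / 2 * T 0)%:E <=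
   \sum_(k < n) (T k.+1)%:E * lam (xsection (layer k) x))%E.
Proof.
move=> xb qn; have /andP[h01 h11] := a01.
have x1 : -1 <= x <= 1 by lra.
have Exy y : 1 - a / 2 <= y <= 1 -> E (x, y) by move=> yb; split; rewrite /= in_itv.
have sub y z : 1 - a / 2 <= y <= 1 -> 1 - a / 2 <= z <= 1 ->
    u (x, y) + q (x, y) * (z - y) <= u (x, z).
  move=> yb zb; have [Oy1 _ _] := EO _ (Exy y yb); have [Oz1 _ _] := EO _ (Exy z zb).
  by have := su _ _ Oy1 Oz1; rewrite /= subrr mulr0 add0r.
have ctn : {within `[1 - a / 2, 1], continuous (fun y => q (x, y))}.
  by apply: q_column_continuous => //; lra.
have incr y z : 1 - a / 2 <= y -> y < z -> z <= 1 -> q (x, y) < q (x, z).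
  by move=> h1 h2 h3; apply: q_increasing => //; lra.
have mx k : measurable (xsection (layer k) x : set (measurableTypeR R)).
  exact: measurable_xsection.
have inL k y : 1 - a / 2 <= y <= 1 -> T k < q (x, y) <= T k.+1 -> xsection (layer k) x y.
  move=> yb qb; apply/xsectionP; have [Oy1 _ _] := EO _ (Exy y yb).
  by split; [exact: Exy|split => //; split => //=; rewrite in_itv].
have b1 : 1 - a / 2 <= (1 : R) <= 1 by lra.
have := @increment_le_layers R (fun y => u (x, y)) (fun y => q (x, y)) T
  (fun k => xsection (layer k) x) (1 - a / 2) 1 T0 sub ctn incr mx inL n 1 b1
  (qn _ (Exy 1 b1)).
have m1 : u (1 - a, 1) <= u (x, 1) by apply: umono; lra.
have m2 : u (x, 1 - a / 2) <= u (1 - a / 2, 1 - a / 2) by apply: umono; lra.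
set S := (\sum_(k < n) _)%E => h.
have hS : (S <= \sum_(k < n) (T k.+1)%:E * lam (xsection (layer k) x))%E.
  apply: lee_sum => k _; apply: lee_pmul => //; first by rewrite lee_fin ltW.
  apply: le_measure; rewrite ?inE //; apply: measurableI => //; exact: measurable_itv.
apply: le_trans hS; apply: (@le_trans _ _ ((u (x, 1) - u (x, 1 - a / 2) - a / 2 * T 0)%:E)).
  rewrite lee_fin; lra.
rewrite EFinB leeBlDr // addeC; apply: le_trans h _.
by rewrite leeD2r // lee_fin; have -> : 1 - (1 - a / 2) = a / 2 by ring.
Qed.

(** Integration over columns of total width $a/2$ turns lengths into layer areas, of weighted sum at
    most $48/K$. This gives $96/(Ka)$, and slopes below [T 0] add $32/(Ka)$. *)
Lemma edge_increment :
  u (1 - a, 1) - u (1 - a / 2, 1 - a / 2) <= 128 / (K * a).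
Proof.
have /andP[h01 h11] := a01.
have [n qn] := q_bounded.
have Ka0 : 0 < K * a by apply: mulr_gt0.
set c := u (1 - a, 1) - u (1 - a / 2, 1 - a / 2).
have TE : a / 2 * T 0 = 32 / (K * a) by rewrite /T /B expr0; field; rewrite !gt_eqF.
have [c0|c0] := leP (c - a / 2 * T 0) 0.
  have : 0 < (K * a)^-1 by rewrite invr_gt0.
  by rewrite TE in c0; lra.
pose D := `[1 - a, 1 - a / 2]%classic : set (measurableTypeR R).
pose F x : \bar R := (\sum_(k < n) (T k.+1)%:E * lam (xsection (layer k) x))%E.
have Tk0 k (A : set (measurableTypeR R)) : (0 <= (T k.+1)%:E * lam A)%E.
  by rewrite mule_ge0 // lee_fin ltW.
have F0 x : (0 <= F x)%E by apply: sume_ge0.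
have mFk k : measurable_fun setT (fun x => ((T k.+1)%:E * lam (xsection (layer k) x))%E).
  by apply: measurable_funeM; exact: measurable_fun_xsection.
have mF : measurable_fun setT F by exact: emeasurable_sum.
have lD : lam D = (a / 2)%:E.
  have := @lebesgue_measure_itv R `[1 - a, 1 - a / 2]; rewrite /= lte_fin ifT; last by lra.
  by rewrite -/D => ->; congr (_%:E); field.
have I1 : (((c - a / 2 * T 0) * (a / 2))%:E <= \int[lam]_(x in D) F x)%E.
  have -> : (((c - a / 2 * T 0) * (a / 2))%:E =
      \int[lam]_(x in D) (cst (c - a / 2 * T 0)%:E x))%E.
    by rewrite integral_cst; [rewrite EFinM -lD|exact: measurable_itv].
  apply: ge0_le_integral => //; first exact: measurable_itv.
  - by move=> x _; rewrite lee_fin ltW.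
  - exact: measurable_funTS.
  - by move=> x; rewrite /D /= in_itv /= => xb; exact: column.
have I2 : (\int[lam]_(x in D) F x <= \int[lam]_x F x)%E.
  by apply: ge0_subset_integral => //; exact: measurable_itv.
have I3 : (\int[lam]_x F x = \sum_(k < n) (T k.+1)%:E * lam2 (layer k))%E.
  rewrite ge0_integral_sum //; apply: eq_bigr => k _.
  by rewrite ge0_integralZl //; [exact: measurable_fun_xsection|rewrite lee_fin ltW].
have I4 : (\sum_(k < n) (T k.+1)%:E * lam2 (layer k) =
    (\sum_(k < n) T k.+1 * fine (lam2 (layer k)))%:E)%E.
  rewrite -sumEFin; apply: eq_bigr => k _.
  have fk : lam2 (layer k) \is a fin_num by apply: (lam2_fin R O oO finO) => // z [_ []].
  by rewrite (EFinM (T k.+1)) fineK.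
have := le_trans I1 I2; rewrite I3 I4 lee_fin => h.
have h2 : \sum_(k < n) T k.+1 * fine (lam2 (layer k)) <= 48 / K.
  apply: (@le_trans _ _ (\sum_(k < n) 24 / K * 2^-1 ^+ k)).
    by apply: ler_sum => k _; exact: layer_area.
  rewrite -mulr_sumr; apply: (@le_trans _ _ (24 / K * 2)); last by lra.
  by rewrite ler_wpM2l ?sum_half_le // divr_ge0 // ltW.
have h3 := le_trans h h2.
have -> : 128 / (K * a) = 32 / (K * a) + 48 / K / (a / 2) by field; rewrite !gt_eqF.
rewrite -lerBlDl -TE ler_pdivlMr // divr_gt0 //.
Qed.

End Edge.

Lemma edge_bound a : 0 < a < 1 -> u (1 - a, 1) - u (0, 0) <= 144 / (K * a ^+ 2).
Proof.
move=> a01; have /andP[a0 a1] := a01.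
have h1 := edge_increment a a01.
have a2 : 0 < a / 2 < 1 by lra.
have h2 := corner_bound R O K p q oO K0 cO finO cm u su sqO sx sy (a / 2) a2.
have Ka : 0 < K * a ^+ 2 by rewrite mulr_gt0 // exprn_gt0.
have h3 : 128 / (K * a) <= 128 / (K * a ^+ 2).
  rewrite ler_pM2l // lef_pV2 ?posrE ?mulr_gt0 // ler_pM2l //.
  by rewrite expr2 ler_piMl // ltW.
have e2 : 4 / (K * (a / 2) ^+ 2) = 16 / (K * a ^+ 2) by field; rewrite !gt_eqF.
have e1 : 144 / (K * a ^+ 2) = 128 / (K * a ^+ 2) + 16 / (K * a ^+ 2) by field; rewrite !gt_eqF.
rewrite e2 in h2; rewrite e1; lra.
Qed.

End EdgeEstimate.

(** * Numerical constants and conclusion *)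

Lemma pi_ge13_5 (R : realType) : 13 / 5 <= pi :> R.
Proof.
have step (s t : R) : s < t -> 0 <= s -> (t - s) / (1 + t ^+ 2) <= atan t - atan s.
  move=> st s0.
  have [x xst ->] := @MVT R atan _ s t st (fun x _ => is_derive1_atan x)
    (@derivable_within_continuous R _ atan `[s, t] (fun x _ =>
       @ex_derive _ _ _ _ _ _ _ (is_derive1_atan x))).
  rewrite mulrC ler_pM2r ?subr_gt0 //.
  have xt : x <= t by rewrite ltW // (itvP xst).
  have x0 : 0 <= x by rewrite (le_trans s0) // ltW // (itvP xst).
  rewrite lef_pV2 ?posrE ?ltr_wpDr ?sqr_ge0 // lerD2l.
  by rewrite ler_pXn2r ?nnegrE // (le_trans x0).
(* Two lower rectangles under $1/(1+t^2)$ give $2/5 + 1/4 = 13/20 \le \pi/4$. A single one would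
   give $\pi \ge 2$, while $K \ge 2/3$ takes $\pi \ge 64/27$. *)
have h1 := step 0 2^-1 ltac:(by rewrite invr_gt0) (lexx _).
have h2 := step 2^-1 1 ltac:(by lra) ltac:(by rewrite invr_ge0).
have e1 : (2^-1 - 0) / (1 + 2^-1 ^+ 2) = 2 / 5 :> R by field.
have e2 : (1 - 2^-1) / (1 + 1 ^+ 2) = 1 / 4 :> R by field.
rewrite e1 atan0 in h1; rewrite e2 atan1 in h2; lra.
Qed.

Theorem theorem5p2 (R : realType) (O : set (R * R)) (u : R * R -> R) :
  open O ->
  strictly_convex_set O ->
  smooth_boundary O ->
  axially_symmetric O ->
  (forall x y : R, -1 <= x <= 1 -> -1 <= y <= 1 -> O (x, y)) ->
  (forall x y : R, O (x, y) -> `|x| <= 4 / 3 /\ `|y| <= 4 / 3) ->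
  convex_fun_on O u ->
  C2_on O u ->
  (forall p, O p -> gauss_curv u p = 2 * pi / area O) ->
  (forall q, closure O q -> ~ O q ->
     gradnorm u x @[x --> within O (nbhs q)] --> +oo) ->
  forall alpha : R, 0 < alpha < 1 / 6 ->
    u (1 - 6 * alpha, -1) - u (0, 0) <= 6 * (1 + 1 / alpha ^+ 2).
Proof.
move=> oO scO _ symO sqO bO cvx C2 gc bd alpha /andP[al0 al1].
have mO := open_measurable_plane R O oO.
have O00 : O (0, 0) by apply: sqO; lra.
have cO x y t : O x -> O y -> 0 <= t <= 1 -> O (t *: x + (1 - t) *: y).
  move=> Ox Oy /andP[]; rewrite le_eqVlt => /orP[/eqP <- _|t0].
    by rewrite scale0r add0r subr0 scale1r.
  rewrite le_eqVlt => /orP[/eqP ->|t1]; first by rewrite subrr scale0r addr0 scale1r.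
  have [->|xy] := eqVneq x y; first by rewrite -scalerDl subrKC scale1r.
  by apply: scO xy _ _; [exact: subset_closure|exact: subset_closure|rewrite t0].
have leO : (lam2 O <= (64 / 9)%:E)%E.
  have h : - (4 / 3) <= 4 / 3 :> R by lra.
  have e : 64 / 9 = (4 / 3 - - (4 / 3)) * (4 / 3 - - (4 / 3)) :> R by field.
  rewrite e -(lam2_rectangle R _ _ _ _ h h).
  apply: le_measure; rewrite ?inE //; first by apply: measurableX; exact: measurable_itv.
  by move=> [x y] /bO[h1 h2]; split; rewrite /= in_itv /= -ler_norml.
have finO : (lam2 O < +oo)%E by apply: le_lt_trans leO _; rewrite ltry.
have finO' : lam2 O \is a fin_num by rewrite ge0_fin_numE.
have A0 : 0 < area O by rewrite -lte_fin fineK // (lam2_open_gt0 R O (0, 0)).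
have A1 : area O <= 64 / 9 by rewrite -lee_fin fineK.
have pi0 := @pi_gt0 R.
set K := 2 * pi / area O in gc.
have K0 : 0 < K by rewrite divr_gt0 // mulr_gt0.
have totO : K * fine (lam2 O) = 2 * pi by rewrite /K /area divfK // gt_eqF.
have K23 : 2 / 3 <= K.
  rewrite ler_pdivlMr //; have := pi_ge13_5 R; lra.
pose p := 'D_(e1 R) u; pose q := 'D_(e2 R) u.
have cm : curvature_map R O K p q by exact: gradient_curvature_map bO cvx C2 gc bd.
have du x : O x -> differentiable u x by move=> /C2[].
have su : subgradient R O u p q by exact: convex_subgradient.
have cu x : O x -> {for x, continuous u} by move=> /du; exact: differentiable_continuous.
(* Uniqueness compares [u] with its composition with a reflection; the sign choices below give the
   parities of [p] and [q]. *)
have unique s1 s2 : s1 * s1 = 1 -> s2 * s2 = 1 ->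
    (forall z, O z -> O (s1 * z.1, s2 * z.2)) -> forall z, O z ->
    p z = s1 * p (s1 * z.1, s2 * z.2) /\ q z = s2 * q (s1 * z.1, s2 * z.2).
  move=> h1 h2 hO z Oz.
  apply: (gradient_unique R O K oO K0 cO finO totO u p q _ _ _ cm
    (curvature_map_refl R O K s1 s2 p q h1 h2 hO cm) su
    (subgradient_refl R O s1 s2 p q u hO su) cu _ z Oz) => x Ox.
  by apply: continuous_refl; apply: cu; exact: hO.
have n1 : (-1) * (-1) = 1 :> R by rewrite mulrNN mulr1.
have hx z : O z -> O (-1 * z.1, 1 * z.2).
  by case: z => x y /symO[h _] /=; rewrite mulN1r mul1r.
have hy z : O z -> O (1 * z.1, -1 * z.2).
  by case: z => x y /symO[_ h] /=; rewrite mulN1r mul1r.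
have sx z : O z -> p (- z.1, z.2) = - p z /\ q (- z.1, z.2) = q z.
  move=> Oz; have [-> ->] := unique (-1) 1 n1 (mulr1 1) hx z Oz.
  by rewrite !mulN1r !mul1r opprK.
have sy z : O z -> p (z.1, - z.2) = p z /\ q (z.1, - z.2) = - q z.
  move=> Oz; have [-> ->] := unique 1 (-1) (mulr1 1) n1 hy z Oz.
  by rewrite !mulN1r !mul1r opprK.
(* Reflection carries the edge $y = -1$ to $y = 1$. By uniqueness [v] has the same gradient $(p,q)$,
   so [cm], [sx] and [sy] serve as they are. *)
pose v z := u (1 * z.1, -1 * z.2).
have sv : subgradient R O v p q.
  move=> x y Ox Oy.
  have [-> ->] := unique 1 (-1) (mulr1 1) n1 hy x Ox.
  exact: (subgradient_refl R O 1 (-1) p q u hy su x y Ox Oy).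
have a01 : 0 < 6 * alpha < 1 by lra.
have h := edge_bound R O K p q v oO K0 cO finO cm sv sqO sx sy (6 * alpha) a01.
rewrite /v /= mulr1 !mulr0 !mul1r in h.
have al2 : 0 < alpha ^+ 2 by rewrite exprn_gt0.
apply: le_trans h _.
have -> : 144 / (K * (6 * alpha) ^+ 2) = 4 / K * (1 / alpha ^+ 2).
  by field; rewrite !gt_eqF.
have ial : 0 <= 1 / alpha ^+ 2 by rewrite divr_ge0 // ltW.
have K6 : 4 / K <= 6 by rewrite ler_pdivrMr //; lra.
have : 4 / K * (1 / alpha ^+ 2) <= 6 * (1 / alpha ^+ 2) by rewrite ler_wpM2r.
rewrite mulrDr; lra.
Qed.
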